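(* Let $S_g$ be an oriented closed connected surface of genus $g$, and let $\mathcal{K}$ be an oriented knot in $S_g\times S^1$, with class $[K]\in H_1(S_g\times S^1;\mathbb{Z})$. For each diagram $D$ of $\mathcal{K}$ and each crossing $c$ of $D$, let $[\gamma_c]\in H_1(S_g\times S^1)/[K]$ be the homological winding parity of $c$. Then the family of maps $c\mapsto[\gamma_c]$, indexed by the diagrams $D$ of $\mathcal{K}$, is a winding parity on diagrams of $\mathcal{K}$ with coefficients in the abelian group $H_1(S_g\times S^1)/[K]$ and with fixed element $a=-[\{*\}\times S^1]$, where $\{*\}\times S^1$ carries the counterclockwise orientation of $S^1$.
   Context: Homology has integer coefficients. $H_1(S_g\times S^1)/[K]$ denotes the quotient of $H_1(S_g\times S^1)$ by the subgroup generated by $[K]$. **Knots and diagrams.** A knot in $S_g\times S^1$ is a smooth embedding of $S^1$ into $S_g\times S^1$. Give $S^1$ the counterclockwise orientation, fix $x_0\in S^1$, and identify $S^1\setminus\{x_0\}$ with $(0,1)$ preserving orientation. Put a representative $K$ of $\mathcal{K}$ in general position: $K$ is transverse to $S_g\times\{x_0\}$; the projection of $K$ to $S_g$ is an immersion whose only singularities are transverse double points; and no double point is the image of a point of $K\cap(S_g\times\{x_0\})$. The diagram $D$ of $K$ on $S_g$ is the image of $K$ under projection to $S_g$, with the following additional data. At each double point, called a crossing, the two preimages have distinct coordinates in $(0,1)$; the one with the larger coordinate lies on the over-strand and the other lies on the under-strand. At each image of a point of $K\cap(S_g\times\{x_0\})$ a ''double line'' mark is placed, recording on which side $K$ is near $S_g\times\{1\}$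 and on which side it is near $S_g\times\{0\}$. The set of crossings of $D$ is denoted $\mathcal{V}(D)$. (If the diagram is drawn on the plane, the additional virtual crossings are not elements of $\mathcal{V}(D)$.) **Elementary moves** $f:D\to D'$ between diagrams of $\mathcal{K}$ are isotopies of diagrams and the following local moves and their inverses: - moves 1, 2, 3: the classical Reidemeister moves performed in a disc containing no double lines; - move 4' (crossing change along $S^1$) at a crossing $v$: near $v$ the over-strand is pushed upward through $S_g\times\{x_0\}$ so that it becomes the under-strand (or the under-strand is pushed downward through $S_g\times\{x_0\}$ so that it becomes the over-strand). The over/under information at $v$ is exchanged and the pushed strand acquires one double line just before and one just after the crossing; - move 5: creation or cancellation of two adjacent double lines on an arc, corresponding to pushing a small piece of the arc through $S_g\times\{x_0\}$. If a crossing $v\in\mathcal{V}(D)$ survives the move, the corresponding crossing of $D'$ is denoted $f_*(v)$. In move 4' at $v$, $f_*(v)$ is the changed crossing. **Winding parity.** Let $A$ be an abelian group and $a\in A$ a fixed element. A winding parity on diagrams of $\mathcal{K}$ with coefficients in $A$ and fixed element $a$ is a family of maps $p_D:\mathcal{V}(D)\to A$, one for each diagram $D$ of $\mathcal{K}$, such that for every elementary move $f:D\to D'$: 1. $p_{D'}(f_*(v))=p_D(v)$ for every crossing $v$ of $D$ for which $f_*(v)$ exists, except for the crossing at which a move 4' is performed; 2. $p_D(v)=0$ if $v$ disappears under a decreasing move 1; 3. $p_D(v_1)=p_D(v_2)$ if $v_1,v_2$ are the two crossings that disappear under a decreasing move 2; 4. for a move 3, $p_D(v_1)+p_D(v_3)=p_D(v_2)$,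 where $v_1$ is the crossing of the top and middle strands, $v_3$ the crossing of the middle and bottom strands, and $v_2$ the crossing of the top and bottom strands; 5. for a move 4' at $v$, $p_D(v)+p_{D'}(f_*(v))=a$. **Homological winding parity.** For a crossing $c$ of a diagram of $K$, let $v_c$ be the vertical segment in $S_g\times(0,1)\subset S_g\times S^1$ going from the preimage of $c$ on the over-strand to the preimage of $c$ on the under-strand. Let $\gamma_c$ be the closed curve formed by $v_c$ followed by the arc of $K$, traversed along the orientation of $K$, from the preimage of $c$ on the under-strand to the preimage of $c$ on the over-strand. The homological winding parity of $c$ is the class $[\gamma_c]\in H_1(S_g\times S^1)/[K]$. *)

(* Defs.v *)
(* [freeg] is the free abelian group on a choiceType. *)
From HB Require Import structures.
From mathcomp Require Import all_boot all_order all_algebra ring_quotient.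
From mathcomp Require Import all_classical all_reals all_analysis.
From mathcomp.multinomials Require Import freeg.

Set Implicit Arguments.
Unset Strict Implicit.
Unset Printing Implicit Defensive.

Import Order.TTheory GRing.Theory Num.Theory.
Import numFieldNormedType.Exports.

Local Open Scope classical_set_scope.
Local Open Scope ring_scope.
Local Open Scope quotient_scope.

(** * Singular homology in degree 1, with integer coefficients *)

Section SingularHomology.
Context {R : realType}.

Definition simplex (n : nat) : set 'rV[R]_n.+1 :=
  [set x | (forall i, 0 <= x 0 i) /\ \sum_i x 0 i = 1].
Arguments simplex n : clear implicits.

Definition face_row n (i : 'I_n.+2) (x : 'rV[R]_n.+1) : 'rV[R]_n.+2 :=
  \row_j (if unlift i j is Some k then x 0 k else 0).

Lemma face_row_simplex n (i : 'I_n.+2) (x : simplex n) :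
  face_row i (set_val x) \in simplex n.+1.
Proof.
have [x0 x1] := set_mem (valP x); rewrite set_valE.
apply/mem_set; split=> [j|].
  by rewrite mxE; case: unliftP => [k _|_] //; exact: x0.
rewrite (bigD1_ord i) //= mxE unlift_none add0r -[RHS]x1.
by apply: eq_bigr => k _; rewrite mxE liftK.
Qed.

Definition face n (i : 'I_n.+2) (x : simplex n) : simplex n.+1 :=
  exist _ (face_row i (set_val x)) (face_row_simplex i x).

Lemma face_row_continuous n (i : 'I_n.+2) : continuous (@face_row n i).
Proof.
move=> x A [P xP PA].
exists (fun _ v => P 0 (fintype.lift i v)) => [u v|y yP].
  by have := xP 0 (fintype.lift i v); rewrite mxE liftK ord1.
apply: PA => u v; rewrite mxE ord1.
case: unliftP => [k ->|->].
  by have := yP 0 k.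
by apply: nbhs_singleton; have := xP 0 i; rewrite mxE unlift_none.
Qed.

Lemma face_continuous n (i : 'I_n.+2) : continuous (@face n i).
Proof.
apply/(@continuous_comp_initial _ _ _ set_val) => x.
apply: (@continuous_comp _ _ _ set_val (face_row i)).
  exact: initial_continuous.
exact: face_row_continuous.
Qed.

Variable X : topologicalType.

Definition singular (n : nat) : set (simplex n -> X) :=
  [set s | continuous s].
Arguments singular n : clear implicits.

Lemma face_singular n (i : 'I_n.+2) (s : singular n.+1) :
  (set_val s \o face i) \in singular n.
Proof.
apply/mem_set => x; apply: continuous_comp; first exact: face_continuous.
exact: (set_mem (valP s)).
Qed.

Definition sface n (s : singular n.+1) (i : 'I_n.+2) : singular n :=
  exist _ (set_val s \o face i) (face_singular i s).

Definition chain (n : nat) := {freeg (singular n) / int}.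

Definition boundary n : chain n.+1 -> chain n :=
  fglift (fun s : singular n.+1 =>
    \sum_(i < n.+2) (-1) ^+ i *: (<< sface s i >> : chain n)).

Definition cycle1 : {pred chain 1} := fun c => boundary c == 0.

Lemma boundaryB n (c d : chain n.+1) :
  boundary (c - d) = boundary c - boundary d.
Proof. exact: lift_is_additive. Qed.

Lemma boundary0 n : @boundary n 0 = 0.
Proof. by rewrite -(subrr (0 : chain n.+1)) boundaryB subrr. Qed.

Lemma cycle1_zmod_closed : zmod_closed cycle1.
Proof.
split=> [|c d]; rewrite /cycle1 !unfold_in ?boundary0 // boundaryB.
by move=> /eqP -> /eqP ->; rewrite subrr.
Qed.

HB.instance Definition _ :=
  GRing.isZmodClosed.Build (chain 1) cycle1 cycle1_zmod_closed.

Definition Z1 := {c : chain 1 | c \in cycle1}.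
HB.instance Definition _ := SubChoice.on Z1.
HB.instance Definition _ := [SubChoice_isSubZmodule of Z1 by <:].

Definition B1 : {pred Z1} :=
  fun z => `[< exists c : chain 2, val z = boundary c >].

Lemma B1_zmod_closed : zmod_closed B1.
Proof.
split=> [|y z]; rewrite /B1 !unfold_in.
  by apply/asboolP; exists 0; rewrite boundary0 raddf0.
move=> /asboolP[c yc] /asboolP[d zd]; apply/asboolP; exists (c - d).
by rewrite boundaryB -yc -zd raddfB.
Qed.

HB.instance Definition _ := GRing.isZmodClosed.Build Z1 B1 B1_zmod_closed.

Definition H1 := {ideal_quot B1}.
HB.instance Definition _ := GRing.Zmodule.on H1.

(* The subgroup of [H1] generated by [k] and the quotient by it. *)
Definition multiples (k : H1) : {pred H1} :=
  fun h => `[< exists m : int, h = k *~ m >].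

Lemma multiples_zmod_closed k : zmod_closed (multiples k).
Proof.
split=> [|y z]; rewrite /multiples !unfold_in.
  by apply/asboolP; exists 0; rewrite mulr0z.
move=> /asboolP[m ->] /asboolP[n ->]; apply/asboolP; exists (m - n).
by rewrite mulrzBr.
Qed.

HB.instance Definition _ k :=
  GRing.isZmodClosed.Build H1 (multiples k) (multiples_zmod_closed k).

Definition H1mod (k : H1) := {ideal_quot (multiples k)}.
HB.instance Definition _ k := GRing.Zmodule.on (H1mod k).

Definition to_H1mod (k h : H1) : H1mod k := \pi_(H1mod k) h.

(* The singular 1-simplex of a path is its composite with
   [(x_0, x_1) |-> x_1].  [loop_class c] is the class of the closed curve [c],
   parametrised by the interval [0, 1]; it is 0 (a dummy value) when [c] is not
   continuous on that interval or not closed. *)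
Definition path_chain (c : R -> X) : chain 1 :=
  let s : simplex 1 -> X := fun x => c (set_val x 0 1) in
  if pselect (s \in singular 1) is left sP then << exist _ s sP >> else 0.

Definition loop_class (c : R -> X) : H1 :=
  \pi_(H1) (insubd (0 : Z1) (path_chain c)).

End SingularHomology.

Arguments H1 : clear implicits.
Arguments H1 R X : rename.
Arguments loop_class {R X}.

(** * The circle and smooth maps *)

Notation plane R := 'rV[R]_2.

(* Counterclockwise orientation is the direction of increasing [t] in
   [circ_exp t]. *)
Definition circle (R : realType) : set (plane R) :=
  [set z | z 0 0 ^+ 2 + z 0 1 ^+ 2 = 1].
Arguments circle R : clear implicits.

Section Circle.
Context {R : realType}.

Definition circ_row (t : R) : plane R :=
  \row_i (if i == 0 then cos (2 * pi * t) else sin (2 * pi * t)).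

Lemma circ_row_circle t : circ_row t \in circle R.
Proof. by apply/mem_set; rewrite /circle /= !mxE/= cos2Dsin2. Qed.

Definition circ_exp (t : R) : circle R :=
  exist _ (circ_row t) (circ_row_circle t).

Definition arc (a b : R) : set (circle R) := circ_exp @` `[a, b].
Definition oarc (a b : R) : set (circle R) := circ_exp @` `]a, b[.

End Circle.

Section Smooth.
Context {R : realType} {V : normedModType R}.

(* [U] is meant to be open. *)
Fixpoint Ck (n : nat) (U : set V) (f : V -> R^o) : Prop :=
  (forall x, U x -> {for x, continuous f}) /\
  if n is m.+1 then
    forall v, (forall x, U x -> derivable f x v) /\ Ck m U (fun x => 'D_v f x)
  else True.

Definition smooth (U : set V) (f : V -> R^o) : Prop := forall n, Ck n U f.

End Smooth.

(** * Closed oriented surfaces *)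

Section Surface.
Context {R : realType}.

(* Only the values of [cmap] on [cdom] and of [cinv] on [cim] matter. *)
Record chart (S : Type) := Chart {
  cdom : set S;
  cmap : S -> plane R;
  cinv : plane R -> S }.

Definition cim S (phi : chart S) : set (plane R) := cmap phi @` cdom phi.

Definition is_chart (S : topologicalType) (phi : chart S) : Prop :=
  [/\ open (cdom phi), open (cim phi),
      forall x, cdom phi x -> cinv phi (cmap phi x) = x,
      forall x, cdom phi x -> {for x, continuous (cmap phi)} &
      forall y, cim phi y -> {for y, continuous (cinv phi)}].

(* The transition map from [phi] to [psi] is smooth with positive Jacobian
   determinant. *)
Definition oriented_compatible (S : Type) (phi psi : chart S) : Prop :=
  let U := cmap phi @` (cdom phi `&` cdom psi) in
  let tau := cmap psi \o cinv phi in
  (forall i, smooth U (fun y => tau y 0 i)) /\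
  forall y, U y -> 0 < \det ('J tau y).

(* Closed connected oriented smooth surfaces. *)
Record surface := Surface {
  surface_space :> topologicalType;
  atlas : set (chart surface_space);
  surface_nonempty : [set: surface_space] !=set0;
  surface_hausdorff : hausdorff_space surface_space;
  surface_compact : compact [set: surface_space];
  surface_connected : connected [set: surface_space];
  atlas_chart : forall phi, atlas phi -> is_chart phi;
  atlas_cover : forall x, exists2 phi, atlas phi & cdom phi x;
  atlas_oriented : forall phi psi,
    atlas phi -> atlas psi -> oriented_compatible phi psi }.

(* [n] disjoint simple closed curves which do not separate [S]; the genus is
   the largest such [n]. *)
Definition nonseparating (S : topologicalType) (n : nat) : Prop :=
  exists c : 'I_n -> circle R -> S,
    [/\ forall i, continuous (c i), forall i, injective (c i),
        trivIset setT (fun i => range (c i)) &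
        connected (~` \bigcup_i range (c i))].

Definition has_genus (S : topologicalType) (g : nat) : Prop :=
  nonseparating S g /\ forall n, nonseparating S n -> (n <= g)%N.

Definition smooth_to_surface (S : surface) (V : normedModType R)
    (U : set V) (f : V -> S) : Prop :=
  (forall x, U x -> {for x, continuous f}) /\
  forall phi, atlas phi -> forall i,
    smooth (U `&` f @^-1` cdom phi) (fun x => cmap phi (f x) 0 i).

Definition smooth_to_circle (V : normedModType R) (U : set V)
    (f : V -> circle R) : Prop :=
  forall i, smooth U (fun x => set_val (f x) 0 i).

End Surface.
Arguments surface R : clear implicits.

(** * Knots in S x S^1 *)

Section Knots.
Context {R : realType} (S : surface R).

Definition knot_map := circle R -> S * circle R.

Implicit Types K : knot_map.

Definition surf_part K (t : R) : S := (K (circ_exp t)).1.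
Definition circ_part K (t : R) : plane R := set_val (K (circ_exp t)).2.

(* Independent of the chart at [f t]. *)
Definition immersed_at (f : R -> S) (t : R) : Prop :=
  forall phi : chart S, atlas phi -> cdom phi (f t) ->
    derive1 (cmap phi \o f) t != 0.

Definition transverse_at (f : R -> S) (s t : R) : Prop :=
  forall phi : chart S, atlas phi -> cdom phi (f s) -> cdom phi (f t) ->
    row_free (col_mx (derive1 (cmap phi \o f) s) (derive1 (cmap phi \o f) t)).

Definition is_knot K : Prop :=
  [/\ injective K,
      smooth_to_surface [set: R^o] (surf_part K),
      smooth_to_circle [set: R^o] (fun t => (K (circ_exp t)).2) &
      forall t, immersed_at (surf_part K) t \/ derive1 (circ_part K) t != 0].

(* Smooth isotopy of oriented knots; the time is real instead of in [0, 1],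
   which allows the same isotopies. *)
Definition isotopic K0 K1 : Prop :=
  exists F : R -> knot_map,
    [/\ F 0 = K0, F 1 = K1, forall u, is_knot (F u),
        smooth_to_surface [set: (R^o * R^o)%type]
          (fun x => (F x.1 (circ_exp x.2)).1) &
        smooth_to_circle [set: (R^o * R^o)%type]
          (fun x => (F x.1 (circ_exp x.2)).2)].

(* The base point of the circle is [circ_exp t0].  The coordinate of [z] in
   (0, 1); it is 0 at the base point. *)
Definition height (t0 : R) (z : circle R) : R :=
  xget 0 [set h | 0 < h < 1 /\ circ_exp (t0 + h) = z].

Definition general_position (t0 : R) K : Prop :=
  [/\ forall t, (K (circ_exp t)).2 = circ_exp t0 -> derive1 (circ_part K) t != 0,
      forall t, immersed_at (surf_part K) t,
      forall s t, circ_exp s != circ_exp t -> surf_part K s = surf_part K t ->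
        transverse_at (surf_part K) s t,
      forall r s t, (K r).1 = (K s).1 -> (K s).1 = (K t).1 ->
        [\/ r = s, s = t | r = t] &
      forall s t, s != t -> (K s).1 = (K t).1 -> (K s).2 <> circ_exp t0].

(** * Diagrams *)

(* A diagram is kept with a parametrisation [curve] of the projection.
   [over s t]: [s] and [t] are the preimages of a crossing, [s] on the
   over-strand and [t] on the under-strand.  [up], [down]: the points carrying
   a double line, [up] (resp. [down]) if the coordinate of K tends to 1
   (resp. 0) before the mark and to 0 (resp. 1) after it. *)
Record diagram := Diagram {
  curve : circle R -> S;
  over : circle R -> circle R -> Prop;
  up : set (circle R);
  down : set (circle R) }.

Implicit Types D : diagram.

Definition marks D : set (circle R) := up D `|` down D.

Definition is_crossing D : set S :=
  [set v | exists s t, over D s t /\ curve D s = v].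

Definition crossing D := set_type (is_crossing D).

Definition diagram_of (t0 : R) K : diagram :=
  let h (t : R) := height t0 (K (circ_exp t)).2 in
  {| curve := fun s => (K s).1;
     over := fun s t => [/\ s != t, (K s).1 = (K t).1 &
                            height t0 (K t).2 < height t0 (K s).2];
     up := [set s | (K s).2 = circ_exp t0 /\
              exists2 t, circ_exp t = s &
                (h x @[x --> t^'-] --> (1 : R)) /\
                (h x @[x --> t^'+] --> (0 : R))];
     down := [set s | (K s).2 = circ_exp t0 /\
              exists2 t, circ_exp t = s &
                (h x @[x --> t^'-] --> (0 : R)) /\
                (h x @[x --> t^'+] --> (1 : R))] |}.

(* [K] represents the isotopy class of [K0] and has diagram [D]. *)
Definition represents (t0 : R) K0 K D : Prop :=
  [/\ is_knot K, isotopic K0 K, general_position t0 K & D = diagram_of t0 K].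

Definition diagram_of_knot (t0 : R) K0 D : Prop :=
  exists K, represents t0 K0 K D.

(** * Elementary moves *)

(* Diagram isotopies: an ambient isotopy [Phi] of S carries [D] to [D'], up to
   an orientation preserving change of parameter [r]. *)
Definition ambient_isotopy (Phi : R -> S -> S) : Prop :=
  let smooth_family (F : R -> S -> S) :=
    forall phi : chart S, atlas phi ->
      smooth_to_surface ([set: R^o] `*` cim phi)
        (fun x : R^o * plane R => F x.1 (cinv phi x.2)) in
  [/\ smooth_family Phi, Phi 0 = id &
      exists Psi : R -> S -> S, smooth_family Psi /\
        forall u, cancel (Phi u) (Psi u) /\ cancel (Psi u) (Phi u)].

Definition circle_reparam (r : R -> R) : Prop :=
  [/\ smooth [set: R^o] (r : R^o -> R^o), forall t, 0 < derive1 r t &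
      forall t, r (t + 1) = r t + 1].

Definition diagram_isotopy D D' (Phi : R -> S -> S) : Prop :=
  ambient_isotopy Phi /\
  exists r : R -> R, circle_reparam r /\
    forall t, let s := circ_exp t in let s' := circ_exp (r t) in
      [/\ curve D' s' = Phi 1 (curve D s),
          forall u, over D' s' (circ_exp (r u)) <-> over D s (circ_exp u),
          up D' s' <-> up D s &
          down D' s' <-> down D s].

Definition unit_disc : set (plane R) :=
  [set x | x 0 0 ^+ 2 + x 0 1 ^+ 2 <= 1].
Definition open_unit_disc : set (plane R) :=
  [set x | x 0 0 ^+ 2 + x 0 1 ^+ 2 < 1].

(* [disc @` unit_disc] is a disc in S, which meets [D] in [n] arcs, the images
   of the disjoint parameter arcs [a i, b i], without double lines. *)
Definition disc_strands n (disc : plane R -> S) (a b : 'I_n -> R) D : Prop :=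
  [/\ forall i, a i < b i < a i + 1,
      trivIset setT (fun i => arc (a i) (b i)),
      curve D @^-1` (disc @` unit_disc) = \bigcup_i arc (a i) (b i),
      forall i, oarc (a i) (b i) `<=` curve D @^-1` (disc @` open_unit_disc) &
      forall i, arc (a i) (b i) `&` marks D = set0].

Definition local_change n (disc : plane R -> S) (a b : 'I_n -> R) D D' : Prop :=
  let outside s := forall i, ~ oarc (a i) (b i) s in
  [/\ {within unit_disc, continuous disc} /\ set_inj unit_disc disc,
      disc_strands disc a b D, disc_strands disc a b D',
      up D' = up D /\ down D' = down D &
      forall s, outside s -> curve D' s = curve D s /\
        forall t, outside t -> (over D' s t <-> over D s t)].

Definition crossings_in (disc : plane R -> S) D : set S :=
  is_crossing D `&` (disc @` unit_disc).

(* At the crossing [v] the strand [i] passes over the strand [j]. *)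
Definition strand_over n (a b : 'I_n -> R) D (i j : 'I_n) (v : S) : Prop :=
  exists s t, [/\ oarc (a i) (b i) s, oarc (a j) (b j) t, over D s t &
                  curve D s = v].

(* The strand [i] meets [v] before [w]. *)
Definition strand_meets n (a b : 'I_n -> R) D (i : 'I_n) (v w : S) : Prop :=
  exists s t, [/\ a i < s, s < t, t < b i, curve D (circ_exp s) = v &
                  curve D (circ_exp t) = w].

(* Decreasing moves 1 and 2. *)
Definition move1 D D' (v : S) : Prop :=
  exists disc (a b : 'I_1 -> R),
    [/\ local_change disc a b D D', crossings_in disc D = [set v],
        strand_over a b D 0 0 v & crossings_in disc D' = set0].

Definition move2 D D' (v1 v2 : S) : Prop :=
  exists disc (a b : 'I_2 -> R),
    [/\ local_change disc a b D D',
        crossings_in disc D = [set v1; v2] /\ v1 <> v2,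
        strand_over a b D 0 1 v1, strand_over a b D 0 1 v2 &
        crossings_in disc D' = set0].

(* The strands 0, 1, 2 are the top, middle and bottom strands; [v1], [v2], [v3]
   are the crossings top/middle, top/bottom, middle/bottom.  The move reverses
   the order of the two crossings on each strand. *)
Definition triangle (disc : plane R -> S) (a b : 'I_3 -> R) D
    (v1 v2 v3 : S) : Prop :=
  let top : 'I_3 := inord 0 in let mid : 'I_3 := inord 1 in
  let bot : 'I_3 := inord 2 in
  [/\ crossings_in disc D = [set v1; v2; v3], strand_over a b D top mid v1,
      strand_over a b D top bot v2 & strand_over a b D mid bot v3].

Definition move3 D D' (v1 v2 v3 w1 w2 w3 : S) : Prop :=
  exists disc (a b : 'I_3 -> R),
    let reversed i v v' w w' :=
      strand_meets a b D i v v' <-> strand_meets a b D' i w' w in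
    [/\ local_change disc a b D D', triangle disc a b D v1 v2 v3,
        triangle disc a b D' w1 w2 w3 &
        [/\ reversed (inord 0) v1 v2 w1 w2, reversed (inord 1) v1 v3 w1 w3 &
            reversed (inord 2) v2 v3 w2 w3]].

(* The strand through [circ_exp t] is pushed across the base point of the
   circle; it is the over-strand pushed upward or the under-strand pushed
   downward. *)
Definition move4 D D' (v : S) : Prop :=
  exists x t y,
    [/\ [/\ x < t, t < y & y < x + 1],
        curve D (circ_exp t) = v /\ is_crossing D v,
        arc x y `&` marks D = set0 /\
          (forall s, arc x y s -> is_crossing D (curve D s) -> s = circ_exp t),
        curve D' = curve D /\
          (forall s s', over D' s s' <->
             (curve D s = v /\ over D s' s) \/ (curve D s <> v /\ over D s s')) &
        ((exists s, over D (circ_exp t) s) /\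
           up D' = up D `|` [set circ_exp x] /\
           down D' = down D `|` [set circ_exp y])
        \/ ((exists s, over D s (circ_exp t)) /\
           down D' = down D `|` [set circ_exp x] /\
           up D' = up D `|` [set circ_exp y])].

(* Creation of two adjacent double lines. *)
Definition move5 D D' : Prop :=
  exists x y,
    [/\ x < y < x + 1,
        arc x y `&` marks D = set0 /\
          (forall s, arc x y s -> ~ is_crossing D (curve D s)),
        curve D' = curve D /\ over D' = over D &
        (up D' = up D `|` [set circ_exp x] /\
           down D' = down D `|` [set circ_exp y])
        \/ (down D' = down D `|` [set circ_exp x] /\
           up D' = up D `|` [set circ_exp y])].

(* [elementary_move f X]: there is an elementary move D -> D'; [f v w] means
   that the crossing [v] survives with [f_* v = w], and [X] is the set of the
   crossings at which a move 4' is performed. *)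
Inductive elementary_move : forall D D',
    (crossing D -> crossing D' -> Prop) -> set (crossing D) -> Prop :=
| em_isotopy D D' Phi : diagram_isotopy D D' Phi ->
    elementary_move
      (fun (v : crossing D) (w : crossing D') => set_val w = Phi 1 (set_val v))
      set0
| em_move1 D D' v : move1 D D' v ->
    elementary_move
      (fun (c : crossing D) (w : crossing D') =>
         set_val c <> v /\ set_val w = set_val c) set0
| em_move2 D D' v1 v2 : move2 D D' v1 v2 ->
    elementary_move
      (fun (c : crossing D) (w : crossing D') =>
         [/\ set_val c <> v1, set_val c <> v2 & set_val w = set_val c]) set0
| em_move3 D D' v1 v2 v3 w1 w2 w3 : move3 D D' v1 v2 v3 w1 w2 w3 ->
    elementary_move
      (fun (c : crossing D) (w : crossing D') =>
         [\/ set_val c = v1 /\ set_val w = w1,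
             set_val c = v2 /\ set_val w = w2,
             set_val c = v3 /\ set_val w = w3 |
             ~ [set v1; v2; v3] (set_val c) /\ set_val w = set_val c]) set0
| em_move4 D D' v : move4 D D' v ->
    elementary_move
      (fun (c : crossing D) (w : crossing D') => set_val w = set_val c)
      [set c | set_val c = v]
| em_move5 D D' : move5 D D' ->
    elementary_move
      (fun (c : crossing D) (w : crossing D') => set_val w = set_val c) set0
| em_inverse D D' (f : crossing D -> crossing D' -> Prop) X :
    elementary_move f X ->
    elementary_move (fun w v => f v w) [set w | exists2 v, X v & f v w].

(** * Winding parity *)

Definition winding_parity (t0 : R) K0 (A : zmodType) (a : A)
    (p : forall D, crossing D -> A) : Prop :=
  let dgm := diagram_of_knot t0 K0 in
  [/\ forall D D' (f : crossing D -> crossing D' -> Prop) X,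
        dgm D -> dgm D' -> elementary_move f X ->
        forall v w, f v w -> ~ X v -> p D' w = p D v,
      forall D D' (v : crossing D),
        dgm D -> dgm D' -> move1 D D' (set_val v) -> p D v = 0,
      forall D D' (v1 v2 : crossing D),
        dgm D -> dgm D' -> move2 D D' (set_val v1) (set_val v2) ->
        p D v1 = p D v2,
      forall D D' (v1 v2 v3 : crossing D) w1 w2 w3,
        dgm D -> dgm D' ->
        move3 D D' (set_val v1) (set_val v2) (set_val v3) w1 w2 w3 ->
        p D v1 + p D v3 = p D v2 &
      forall D D' (v : crossing D) (v' : crossing D'),
        dgm D -> dgm D' -> move4 D D' (set_val v) -> set_val v' = set_val v ->
        p D v + p D' v' = a].

(* The closed curve of the crossing with over-preimage [circ_exp x] and
   under-preimage [circ_exp y], where [y < x < y + 1]: the vertical segment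
   during [0, 1/2], then the arc of [K]. *)
Definition crossing_loop (t0 : R) K (x y : R) (u : R) : S * circle R :=
  let hx := height t0 (K (circ_exp x)).2 in
  let hy := height t0 (K (circ_exp y)).2 in
  if u <= 2^-1
  then ((K (circ_exp x)).1, circ_exp (t0 + (1 - 2 * u) * hx + 2 * u * hy))
  else K (circ_exp (y + (2 * u - 1) * (x - y))).

Definition knot_class K : H1 R (S * circle R)%type := loop_class (K \o circ_exp).

(* [{z} x S^1], counterclockwise. *)
Definition fiber_class (z : S) : H1 R (S * circle R)%type :=
  loop_class (fun u => (z, circ_exp u)).

Definition parity_class (t0 : R) K0 K (x y : R) : H1mod (knot_class K0) :=
  to_H1mod (knot_class K0) (loop_class (crossing_loop t0 K x y)).

(* [x] and [y] are parameters of the over- and under-preimage of [c]. *)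
Definition crossing_parameters D (c : S) (x y : R) : Prop :=
  [/\ y < x < y + 1, over D (circ_exp x) (circ_exp y) &
      curve D (circ_exp x) = c].

(* A priori [gamma_c] depends on the representative of the diagram. *)
Definition homological_winding_parity (t0 : R) K0 D (c : crossing D) :
    H1mod (knot_class K0) :=
  xget 0 [set h | exists K x y, [/\ represents t0 K0 K D,
    crossing_parameters D (set_val c) x y & h = parity_class t0 K0 K x y]].

End Knots.

(* Main.v *)
From HB Require Import structures.
From mathcomp Require Import all_boot all_order all_algebra ring_quotient.
From mathcomp Require Import all_classical all_reals all_analysis.
From mathcomp.multinomials Require Import freeg.
From mathcomp Require Import ring lra zify.
Require Import Defs.
Set Implicit Arguments.
Unset Strict Implicit.
Unset Printing Implicit Defensive.
Import Order.TTheory GRing.Theory Num.Theory.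
Import numFieldNormedType.Exports.
Local Open Scope classical_set_scope.
Local Open Scope ring_scope.
Local Open Scope quotient_scope.

(** Fix the knot [K0] and work in the group of singular 1-chains modulo
    boundaries and modulo the loop [K0].  The quotient of the first homology by
    the class of [K0] embeds in it ([H1mod_chain_inj]), and in it an open arc has
    a class, additive under concatenation, so a closed curve can be cut into arcs
    that are compared separately.  For two parameters [x], [y] of one double
    point, [double_point_class K x y] is the class of the vertical segment
    followed by the arc of [K]; modulo [K0] it depends only on the two points
    of the circle, and at a crossing it is the parity ([H1mod_chain_parity]).

    A diagram determines the knot up to a homotopy that keeps it.  The height of
    a knot jumps exactly at the double lines, by an amount that the kind of the
    line prescribes.  Hence the difference of the heights of two knots with the
    same double lines is continuous, and linear interpolation of this difference,
    together with a homotopy of the projections, joins the two knots.  If the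
    double lines differ by a push of an arc through the base level, the
    difference becomes continuous after 1 is added on this arc.
    [double_point_class_homotopy] compares the classes of the two ends of such a
    homotopy: they differ only by the vertical loops that come from the added
    integers.  This gives at once that the parity does not depend on the
    representative, that it is invariant under isotopies, under move 5 and at
    the crossings outside the region of any other move.  In a move 4' the loops of
    the old and the new crossing have opposite vertical segments and opposite
    arcs, so their classes cancel up to one fibre.  All fibres are homologous
    because the surface is connected.

    For moves 1, 2 and 3, let a disc meet the knot in strands without double
    lines.  The part of the knot over the disc lifts to plane x R, which is
    contractible, so there the class of an arc is the difference of a potential
    at its endpoints.  Comparing the potential with the arcs of the knot gives
    one constant [strand_const] for each strand, and the parity of a crossing of
    a strand [i] over a strand [j] is the constant of [j] minus that of [i]
    ([parity_strands]).  The relations of moves 1, 2 and 3 are then identities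
    between such differences.  The crossings of a move 3 keep their parity
    because the move changes all the constants by the same amount
    ([local_change_strand_const]). *)

(** * Continuity of composite maps *)

Section ContinuityRules.
Context {R : realType} {V : normedModType R} {T U W : topologicalType}.

Lemma continuous_addf (f g : T -> V) :
  continuous f -> continuous g -> continuous (fun x => f x + g x).
Proof. by move=> cf cg x; apply: cvgD; [exact: cf|exact: cg]. Qed.

Lemma continuous_scalef (f : T -> R) (g : T -> V) :
  continuous f -> continuous g -> continuous (fun x => f x *: g x).
Proof. by move=> cf cg x; apply: cvgZ; [exact: cf|exact: cg]. Qed.

Lemma continuous_oppf (f : T -> V) :
  continuous f -> continuous (fun x => - f x).
Proof. by move=> cf x; apply: cvgN; exact: cf. Qed.

Lemma continuous_mulf (f g : T -> R) :
  continuous f -> continuous g -> continuous (fun x => f x * g x).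
Proof. by move=> cf cg x; apply: cvgM; [exact: cf|exact: cg]. Qed.

Lemma continuous_pairf (f : T -> U) (g : T -> W) :
  continuous f -> continuous g -> continuous (fun x => (f x, g x)).
Proof. by move=> cf cg x; apply: cvg_pair; [exact: cf|exact: cg]. Qed.

Lemma continuous_compf (f : T -> U) (g : U -> W) :
  continuous f -> continuous g -> continuous (fun x => g (f x)).
Proof. by move=> cf cg x; apply: continuous_comp; [exact: cf|exact: cg]. Qed.

Lemma continuous_cstf (a : U) : continuous (fun _ : T => a).
Proof. by move=> x; exact: cvg_cst. Qed.

Lemma continuous_idf : continuous (fun x : T => x).
Proof. by move=> x; exact: cvg_id. Qed.

Lemma continuous_fstf : continuous (fun x : T * U => x.1).
Proof. by move=> x; exact: cvg_fst. Qed.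

Lemma continuous_sndf : continuous (fun x : T * U => x.2).
Proof. by move=> x; exact: cvg_snd. Qed.

End ContinuityRules.

(** * Chains modulo boundaries and a fixed loop *)

Section ChainQuotient.
Context {R : realType} {X : topologicalType}.
Variable k : chain (R := R) X 1.

(** Chains are used instead of cycles so that open arcs have a class. *)
Definition trivial_chain : {pred chain (R := R) X 1} :=
  fun c => `[< exists m (e : chain X 2), c = boundary e + k *~ m >].

Lemma trivial_chain_zmod_closed : zmod_closed trivial_chain.
Proof.
split=> [|c d]; rewrite /trivial_chain !unfold_in.
  by apply/asboolP; exists 0, 0; rewrite boundary0 mulr0z addr0.
move=> /asboolP[m [e ->]] /asboolP[n [f ->]]; apply/asboolP.
by exists (m - n), (e - f); rewrite boundaryB mulrzBr opprD addrACA.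
Qed.

HB.instance Definition _ := GRing.isZmodClosed.Build
  (chain (R := R) X 1) trivial_chain trivial_chain_zmod_closed.

Definition chain_quot := {ideal_quot trivial_chain}.
HB.instance Definition _ := GRing.Zmodule.on chain_quot.

Definition chain_class (c : chain (R := R) X 1) : chain_quot := \pi_chain_quot c.

Lemma chain_classB c d : chain_class (c - d) = chain_class c - chain_class d.
Proof. exact: (raddfB (\pi_({ideal_quot trivial_chain})%qT : {additive _ -> _})). Qed.

Lemma chain_class_eq0 c : chain_class c = 0 <-> c \in trivial_chain.
Proof.
rewrite /chain_class -[c in X in _ <-> X]subr0 Quotient.idealrBE.
have p0 := raddf0 (\pi_({ideal_quot trivial_chain})%qT : {additive _ -> _}).
by split=> [->|/eqP ->]; rewrite p0.
Qed.

Lemma chain_class0 : chain_class 0 = 0.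
Proof. by rewrite -[X in chain_class X](subrr 0) chain_classB subrr. Qed.

Lemma chain_classD c d : chain_class (c + d) = chain_class c + chain_class d.
Proof.
rewrite -{1}[d]opprK chain_classB -[- d]sub0r chain_classB chain_class0.
by rewrite sub0r opprK.
Qed.

Definition path_class (c : R -> X) : chain_quot := chain_class (path_chain c).

(** A singular 1-simplex only sees the parameters in [[0, 1]]. *)
Lemma path_class_ext (c d : R -> X) :
  (forall u, 0 <= u <= 1 -> c u = d u) -> path_class c = path_class d.
Proof.
move=> cd; rewrite /path_class; congr chain_class.
rewrite /path_chain.
have -> : (fun x : @simplex R 1 => c (set_val x 0 1)) =
          (fun x : @simplex R 1 => d (set_val x 0 1)).
  apply/funext => x; apply: cd; have [x0 x1] := set_mem (valP x).
  rewrite x0 /= -x1 (bigD1 1) //= lerDl.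
  by apply: sumr_ge0 => i _; exact: x0.
by [].
Qed.

Lemma simplex_coord_continuous n (i : 'I_n.+1) :
  continuous (fun x : @simplex R n => set_val x 0 i).
Proof.
move=> x; apply: (@continuous_comp _ _ _ set_val (fun y : 'rV[R]_n.+1 => y 0 i)).
  exact: initial_continuous.
exact: coord_continuous.
Qed.

Lemma path_chainE (c : R -> X) : continuous c ->
  exists2 s : @singular R X 1, path_chain c = << s >> &
     forall x, set_val s x = c (set_val x 0 1).
Proof.
move=> cc; rewrite /path_chain; case: pselect => [p|[]].
  by exists (exist (fun f => f \in @singular R X 1) _ p).
apply/mem_set => x.
by apply: continuous_comp; [exact: simplex_coord_continuous|exact: cc].
Qed.

End ChainQuotient.

(** * Classes of segments and arcs *)

Section Segments.
Context {R : realType} {X : topologicalType} {V : normedModType R}.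
Variable k : chain (R := R) X 1.

Definition segment_class (F : V -> X) (p q : V) :=
  path_class k (fun u => F (p + u *: (q - p))).

Lemma continuous_segment (p q : V) : continuous (fun u : R => p + u *: (q - p)).
Proof.
move=> u; apply: cvgD; first exact: cvg_cst.
by apply: cvgZ; [exact: cvg_id|exact: cvg_cst].
Qed.

(** The three segments are the faces of the affine triangle [p q r], seen
    through [F]. *)
Lemma segment_classD (F : V -> X) p q r : continuous F ->
  segment_class F p q + segment_class F q r = segment_class F p r.
Proof.
move=> cF.
have cs x y : continuous (fun u : R => F (x + u *: (y - x))).
  move=> u; apply: (@continuous_comp _ _ _ (fun u : R => x + u *: (y - x))).
    exact: continuous_segment.
  exact: cF.
pose t (x : @simplex R 2) : X :=
  F (set_val x 0 0 *: p + set_val x 0 1 *: q + set_val x 0 2 *: r).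
have tP : t \in @singular R X 2.
  apply/mem_set; rewrite /singular /=.
  have cz (i : 'I_3) (v : V) :
      continuous (fun y : @simplex R 2 => set_val y 0 i *: v).
    apply: continuous_scalef; last exact: continuous_cstf.
    exact: simplex_coord_continuous.
  apply: continuous_compf cF; apply: continuous_addf => //.
  exact: continuous_addf.
pose T : @singular R X 2 := exist (fun f => f \in @singular R X 2) t tP.
have [s1 c1 e1] := path_chainE (cs p q).
have [s2 c2 e2] := path_chainE (cs q r).
have [s3 c3 e3] := path_chainE (cs p r).
rewrite /segment_class /path_class c1 c2 c3.
apply/eqP; rewrite -subr_eq0 -chain_classD -chain_classB; apply/eqP.
apply/chain_class_eq0/asboolP; exists 0, (<< T >> : chain X 2).
rewrite mulr0z addr0 /boundary liftU scale1r !big_ord_recl big_ord0 addr0.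
rewrite /= !expr0 expr1 scale1r scaleN1r expr2 mulrNN mulr1 scale1r.
have x0E (x : @simplex R 1) : set_val x 0 0 = 1 - set_val x 0 1.
  have [_ <-] := set_mem (valP x); rewrite (bigD1 1) //= (bigD1 0) //= big1 ?addr0.
    by rewrite addrAC subrr add0r.
  by case=> [[|[]]].
have faceE (i : 'I_3) (s : @singular R X 1) (a b : V) :
    (forall x, set_val s x = F (a + set_val x 0 1 *: (b - a))) ->
    (forall x : @simplex R 1, set_val (face i x) 0 0 *: p +
      set_val (face i x) 0 1 *: q + set_val (face i x) 0 2 *: r =
      set_val x 0 0 *: a + set_val x 0 1 *: b) -> sface T i = s.
  move=> sE fE; apply/val_inj/funext => x; rewrite [RHS]sE.
  transitivity (t (face i x)); first by []; rewrite /t fE x0E; congr F.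
  by rewrite scalerBr scalerBl scale1r addrA addrAC.
have f0 (i : 'I_3) (x : @simplex R 1) : set_val (face i x) 0 i = 0.
  by rewrite set_valE /= mxE unlift_none.
have f1 (i j : 'I_3) (m : 'I_2) (x : @simplex R 1) :
    fintype.lift i m = j -> set_val (face i x) 0 j = set_val x 0 m.
  by move=> <-; rewrite set_valE /= mxE liftK.
rewrite (faceE ord0 s2 q r) //; last first.
  move=> x; rewrite (f0 0) (f1 0 1 0) ?(f1 0 2 1) ?scale0r ?add0r //; exact/val_inj.
rewrite (faceE (fintype.lift ord0 ord0) s3 p r) //; last first.
  rewrite (_ : fintype.lift _ _ = 1); last exact/val_inj.
  move=> x; rewrite (f0 1) (f1 1 0 0) ?(f1 1 2 1) ?scale0r ?addr0 //; exact/val_inj.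
rewrite (faceE (fintype.lift ord0 (fintype.lift ord0 ord0)) s1 p q) //; last first.
  rewrite (_ : fintype.lift _ _ = 2); last exact/val_inj.
  move=> x; rewrite (f0 2) (f1 2 0 0) ?(f1 2 1 1) ?scale0r ?addr0 //; exact/val_inj.
by rewrite addrA [RHS]addrC addrA.
Qed.

Lemma segment_classxx (F : V -> X) p : continuous F -> segment_class F p p = 0.
Proof. by move=> cF; apply: (addrI (segment_class F p p)); rewrite segment_classD ?addr0. Qed.

Lemma segment_classN (F : V -> X) p q : continuous F ->
  segment_class F q p = - segment_class F p q.
Proof.
by move=> cF; apply/eqP; rewrite -addr_eq0 segment_classD ?segment_classxx.
Qed.

End Segments.

Section Arcs.
Context {R : realType} {X : topologicalType}.
Variable k : chain (R := R) X 1.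

Definition arc_class (c : R -> X) (s t : R) := segment_class k (c : R^o -> X) s t.

Lemma arc_classD c r s t : continuous c ->
  arc_class c r s + arc_class c s t = arc_class c r t.
Proof. exact: segment_classD. Qed.

Lemma arc_classN c s t : continuous c -> arc_class c t s = - arc_class c s t.
Proof. exact: segment_classN. Qed.

Lemma arc_classxx c s : continuous c -> arc_class c s s = 0.
Proof. exact: segment_classxx. Qed.

Lemma arc_class_ext c d (s t s' t' : R) : (forall u : R, 0 <= u <= 1 ->
    c (s + u * (t - s)) = d (s' + u * (t' - s'))) ->
  arc_class c s t = arc_class d s' t'.
Proof. by move=> cd; apply: path_class_ext. Qed.

Lemma arc_class_period (c : R -> X) s : continuous c -> (forall u, c (u + 1) = c u) ->
  arc_class c s (s + 1) = arc_class c 0 1.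
Proof.
move=> cc per; have shift : arc_class c 1 (s + 1) = arc_class c 0 s.
  by apply: arc_class_ext => u _; rewrite -[RHS]per; congr c; ring.
rewrite -(arc_classD s 0 (s + 1)) // -(arc_classD 0 1 (s + 1)) // shift.
by rewrite addrCA arc_classD // arc_classxx // addr0.
Qed.

(** The diagonal cuts the square [[0, 1] x [s, t]] into two triangles, whose
    boundaries are computed by [segment_classD]. *)
Lemma homotopy_class (H : R -> R -> X) s t :
  continuous (fun p : R * R => H p.1 p.2) ->
  arc_class (H 1) s t - arc_class (H 0) s t =
  arc_class (H^~ t) 0 1 - arc_class (H^~ s) 0 1.
Proof.
move=> cH; pose F (p : R^o * R^o) := H p.1 p.2.
have cF : continuous F by exact: cH.
have hE u : arc_class (H u) s t = segment_class k F (u, s) (u, t).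
  apply: path_class_ext => v _; rewrite /F /=; congr H.
  by rewrite subrr scaler0 addr0.
have vE u : arc_class (H^~ u) 0 1 = segment_class k F (0, u) (1, u).
  apply: path_class_ext => v _; rewrite /F /=; congr H.
  by rewrite subrr scaler0 addr0.
rewrite !hE !vE; apply/eqP; rewrite subr_eq addrAC eq_sym subr_eq; apply/eqP.
by rewrite addrC segment_classD // addrC segment_classD.
Qed.

(** The straight-line homotopy from [p] to the segment has constant tracks at
    both ends. *)
Lemma lifted_class (V : normedModType R) (F : V -> X) (p : R -> V) s t :
  continuous F -> continuous p ->
  arc_class (F \o p) s t = segment_class k F (p s) (p t).
Proof.
move=> cF cp.
pose q (u : R) : V := p s + u *: (p t - p s).
pose r (u : R) : V := p (s + u * (t - s)).
have cq : continuous q by exact: continuous_segment.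
have cr : continuous r.
  apply: continuous_compf cp; exact: (@continuous_segment R R^o).
have r0 : r 0 = p s by rewrite /r mul0r addr0.
have q0 : q 0 = p s by rewrite /q scale0r addr0.
have r1 : r 1 = p t by rewrite /r mul1r addrC subrK.
have q1 : q 1 = p t by rewrite /q scale1r addrC subrK.
have cH : continuous (fun x : R * R => F ((1 - x.1) *: r x.2 + x.1 *: q x.2)).
  apply: continuous_compf cF; apply: continuous_addf; apply: continuous_scalef.
  - apply: continuous_addf; first exact: continuous_cstf.
    by apply: continuous_oppf; exact: continuous_fstf.
  - by apply: continuous_compf cr; exact: continuous_sndf.
  - exact: continuous_fstf.
  - by apply: continuous_compf cq; exact: continuous_sndf.
have := @homotopy_class (fun u v => F ((1 - u) *: r v + u *: q v)) 0 1 cH.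
rewrite [X in _ = X - _ -> _](@arc_class_ext _ (fun=> F (p t)) 0 1 0 1); last first.
  by move=> u _; rewrite /= r1 q1 -scalerDl subrK scale1r.
rewrite [X in _ = _ - X -> _](@arc_class_ext _ (fun=> F (p s)) 0 1 0 1); last first.
  by move=> u _; rewrite /= r0 q0 -scalerDl subrK scale1r.
have cc x : arc_class (fun=> x) 0 1 = 0.
  rewrite -[RHS](@arc_classxx (fun=> x) 0); last exact: continuous_cstf.
  exact: path_class_ext.
rewrite !cc [in RHS]subrr => /subr0_eq e.
have u01 (u : R) : 0 + u *: (1 - 0) = u :> R^o.
  by rewrite subr0 add0r -[RHS]mulr1.
transitivity (arc_class (F \o r) 0 1).
  by apply: path_class_ext => u _; rewrite /= u01.
transitivity (arc_class (F \o q) 0 1); last first.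
  by apply: path_class_ext => u _; rewrite /= u01.
transitivity (arc_class (fun v => F ((1 - 0) *: r v + 0 *: q v)) 0 1).
  by apply: path_class_ext => u _; rewrite /= subr0 scale1r scale0r addr0.
rewrite -e.
by apply: path_class_ext => u _; rewrite /= subrr scale1r scale0r add0r.
Qed.

Lemma arc_class_reparam c (r : R -> R) s t : continuous c -> continuous r ->
  arc_class (c \o r) s t = arc_class c (r s) (r t).
Proof. by move=> cc cr; exact: (@lifted_class R^o). Qed.

End Arcs.

(** * Homology classes of loops in the quotient of the chains *)

Section LoopClasses.
Context {R : realType} {X : topologicalType}.

Lemma loop_cycle (c : R -> X) : continuous c -> c 0 = c 1 ->
  path_chain c \in cycle1 (R := R) (X := X).
Proof.
move=> cc c01; have [s -> sE] := path_chainE cc.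
rewrite /cycle1 unfold_in /boundary liftU scale1r !big_ord_recl big_ord0 addr0.
rewrite expr0 expr1 scale1r scaleN1r subr_eq0; apply/eqP; congr << _ >>.
apply/val_inj/funext => x; transitivity (set_val s (face ord0 x)) => //.
transitivity (set_val s (face (fintype.lift ord0 ord0) x)) => //.
have x1 : set_val x 0 0 = 1.
  by have [_ <-] := set_mem (valP x); rewrite big_ord1.
rewrite !sE !set_valE /= !mxE.
case: unliftP => [j /(congr1 val)/= j0|//]; rewrite ?ord1 ?x1.
case: unliftP => [m /(congr1 val)/=|_]; first by rewrite ord1.
by rewrite c01.
Qed.

Lemma loop_classE (c : R -> X) : continuous c -> c 0 = c 1 ->
  exists2 z : Z1 (R := R) X, loop_class c = \pi z & val z = path_chain c.
Proof.
move=> cc c01; exists (insubd (0 : Z1 (R := R) X) (path_chain c)) => //.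
by rewrite insubdK //; exact: loop_cycle.
Qed.

Let valB (y z : Z1 (R := R) X) : val (y - z) = val y - val z.
Proof. exact: raddfB. Qed.

Let valM (z : Z1 (R := R) X) (m : int) : val (z *~ m) = val z *~ m.
Proof. exact: raddfMz. Qed.

Variable l : R -> X.
Hypotheses (cl : continuous l) (l01 : l 0 = l 1).
Local Notation k := (path_chain l).
Local Notation Hk := (H1mod (loop_class l)).

(** Both sides say that the cycle is a boundary plus a multiple of [l]; a chain
    of this form is automatically a cycle since [l] is one. *)
Lemma H1mod_eq0 (z : Z1 (R := R) X) :
  to_H1mod (loop_class l) (\pi z) = 0 <-> chain_class k (val z) = 0.
Proof.
have [zl zlE zlv] := loop_classE cl l01.
set pB1 := (\pi_({ideal_quot (@B1 R X)})%qT : {additive _ -> _}).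
set pK := (\pi_({ideal_quot (multiples (loop_class l))})%qT : {additive _ -> _}).
rewrite chain_class_eq0 /to_H1mod; split.
  rewrite -[X in _ = X -> _](raddf0 pK) => /eqP; rewrite -Quotient.idealrBE subr0.
  rewrite unfold_in => /asboolP[m]; rewrite zlE -[RHS](raddfMz pB1) => /eqP.
  rewrite -Quotient.idealrBE unfold_in => /asboolP[e].
  rewrite valB valM zlv => /eqP; rewrite subr_eq => /eqP ze.
  by apply/asboolP; exists m, e.
rewrite unfold_in => /asboolP[m [e ze]].
rewrite -[X in _ = X](raddf0 pK); apply/eqP; rewrite -Quotient.idealrBE subr0.
rewrite unfold_in; apply/asboolP; exists m; rewrite zlE -[RHS](raddfMz pB1).
apply/eqP; rewrite -Quotient.idealrBE unfold_in; apply/asboolP; exists e.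
by rewrite valB valM zlv ze addrK.
Qed.

(** The map induced by the inclusion of the cycles into the chains. *)
Definition H1mod_chain (h : Hk) : chain_quot k :=
  chain_class k (val (repr (repr h : H1 R X))).

Lemma H1mod_chainE (z : Z1 (R := R) X) :
  H1mod_chain (to_H1mod (loop_class l) (\pi z)) = chain_class k (val z).
Proof.
set h := to_H1mod _ _; rewrite /H1mod_chain.
set w := repr (repr h : H1 R X).
have hE : to_H1mod (loop_class l) (\pi w) = h by rewrite /w reprK /to_H1mod reprK.
set pB1 := (\pi_({ideal_quot (@B1 R X)})%qT : {additive _ -> _}).
set pK := (\pi_({ideal_quot (multiples (loop_class l))})%qT : {additive _ -> _}).
apply/eqP; rewrite -subr_eq0 -chain_classB -valB; apply/eqP/H1mod_eq0.
by rewrite /to_H1mod (raddfB pB1) (raddfB pK) [pK _]hE subrr.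
Qed.

Lemma H1mod_repr (h : Hk) : exists z : Z1 (R := R) X, h = to_H1mod (loop_class l) (\pi z).
Proof. by exists (repr (repr h : H1 R X)); rewrite reprK /to_H1mod reprK. Qed.

Lemma H1mod_chainB g h : H1mod_chain (g - h) = H1mod_chain g - H1mod_chain h.
Proof.
have [y ->] := H1mod_repr g; have [z ->] := H1mod_repr h.
set pB1 := (\pi_({ideal_quot (@B1 R X)})%qT : {additive _ -> _}).
set pK := (\pi_({ideal_quot (multiples (loop_class l))})%qT : {additive _ -> _}).
rewrite /to_H1mod -(raddfB pK) -(raddfB pB1) [X in X = _]H1mod_chainE.
rewrite [H1mod_chain (\pi_Hk (\pi y))]H1mod_chainE.
by rewrite [H1mod_chain (\pi_Hk (\pi z))]H1mod_chainE valB chain_classB.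
Qed.

Lemma H1mod_chain_inj : injective H1mod_chain.
Proof.
move=> g h gh; apply: subr0_eq; move: (H1mod_chainB g h); rewrite gh subrr.
by have [z ->] := H1mod_repr (g - h); rewrite H1mod_chainE => /H1mod_eq0.
Qed.

Lemma H1mod_chain0 : H1mod_chain 0 = 0.
Proof. by rewrite -[X in H1mod_chain X](subrr 0) H1mod_chainB subrr. Qed.

Lemma H1mod_chainN h : H1mod_chain (- h) = - H1mod_chain h.
Proof. by rewrite -[- h]sub0r H1mod_chainB H1mod_chain0 sub0r. Qed.

Lemma H1mod_chainD g h : H1mod_chain (g + h) = H1mod_chain g + H1mod_chain h.
Proof. by rewrite -{1}[h]opprK H1mod_chainB H1mod_chainN opprK. Qed.

Lemma H1mod_chain_loop (c : R -> X) : continuous c -> c 0 = c 1 ->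
  H1mod_chain (to_H1mod (loop_class l) (loop_class c)) = arc_class k c 0 1.
Proof.
move=> cc c01; have [z -> zv] := loop_classE cc c01.
rewrite H1mod_chainE zv; apply: path_class_ext => u _.
by congr c; rewrite subr0 add0r -[LHS]mulr1.
Qed.

Lemma arc_class_loop : arc_class k l 0 1 = 0.
Proof.
transitivity (chain_class k k).
  by apply: path_class_ext => u _; rewrite subr0 add0r -[in RHS](mulr1 u).
apply/chain_class_eq0/asboolP; exists 1, 0.
by rewrite boundary0 add0r mulr1z.
Qed.

End LoopClasses.

(** * The circle *)

Section CircleFacts.
Context {R : realType}.
Implicit Types (s t u h : R) (z : circle R).

Lemma circ_expc t : set_val (circ_exp t) 0 0 = cos (2 * pi * t).
Proof. by rewrite set_valE /= mxE. Qed.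

Lemma circ_exps t : set_val (circ_exp t) 0 1 = sin (2 * pi * t).
Proof. by rewrite set_valE /= mxE. Qed.

Lemma ord2 (i : 'I_2) : i = 0 \/ i = 1.
Proof. by case: i => [[|[|//]] p]; [left|right]; exact/val_inj. Qed.

Lemma circle_eq z (w : circle R) : set_val z 0 0 = set_val w 0 0 ->
  set_val z 0 1 = set_val w 0 1 -> z = w.
Proof.
move=> z0 z1; apply/val_inj/rowP => i; rewrite -!set_valE.
by have [->|->] := ord2 i.
Qed.

Lemma circ_expDint t (n : int) : circ_exp (t + n%:~R) = circ_exp t.
Proof.
have eD1 s : circ_exp (s + 1) = circ_exp s.
  apply: circle_eq; rewrite ?circ_expc ?circ_exps mulrDr mulr1 mulr_natl.
    exact: cosD2pi.
  exact: sinD2pi.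
have eDn s m : circ_exp (s + m%:R) = circ_exp s.
  by elim: m => [|m ih]; rewrite ?addr0// -natr1 addrA eD1.
case: n => n; first exact: eDn.
by rewrite NegzE rmorphN /= -[in RHS](subrK (n.+1%:R) t) eDn.
Qed.

Lemma circ_expD1 t : circ_exp (t + 1) = circ_exp t.
Proof. exact: (circ_expDint t 1). Qed.

Lemma circ_expP s t : circ_exp s = circ_exp t <-> exists n : int, s = t + n%:~R.
Proof.
split=> [st|[n ->]]; last exact: circ_expDint.
pose d := s - t; exists (Num.floor d).
have /andP[d0 d1] := floor_itv d; rewrite intrD in d1.
pose f := d - (Num.floor d)%:~R.
suff : f = 0 by rewrite /f /d => ?; lra.
have cf : cos (2 * pi * f) = 1.
  transitivity (set_val (circ_exp (f + (Num.floor d)%:~R)) 0 0).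
    by rewrite circ_expDint circ_expc.
  rewrite subrK circ_expc /d mulrBr cosB -!circ_expc -!circ_exps st.
  by have := set_mem (valP (circ_exp t)); rewrite -!set_valE /circle /= -!expr2.
have [//|f0] := eqVneq f 0.
have fgt : 0 < f by rewrite lt_def f0 /f subr_ge0.
have flt : f < 1 by rewrite /f; lra.
have sgt : 0 < sin (pi * f).
  by apply: sin_gt0_pi; rewrite mulr_gt0 ?pi_gt0 //= gtr_pMr ?pi_gt0.
move: cf; rewrite -mulrA mulr_natl cos_mulr2n cos2sin2 => cf.
suff : sin (pi * f) ^+ 2 = 0 by move=> /eqP; rewrite sqrf_eq0 gt_eqF.
by move: cf; rewrite mulr2n; lra.
Qed.

Lemma circ_exp_surj z : exists t, circ_exp t = z.
Proof.
have zP : set_val z 0 0 ^+ 2 + set_val z 0 1 ^+ 2 = 1.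
  by have := set_mem (valP z); rewrite -!set_valE.
set a := set_val z 0 0 in zP; set b := set_val z 0 1 in zP.
have a1 : -1 <= a <= 1.
  rewrite -ler_norml -(@expr_le1 _ 2) ?normr_ge0 // real_normK ?num_real //.
  by rewrite -zP lerDl sqr_ge0.
have sb : sin (acos a) = `|b|.
  by rewrite sin_acos // -zP addrAC subrr add0r sqrtr_sqr.
have p0 : 2 * pi != 0 :> R by rewrite mulf_neq0 ?pnatr_eq0 // gt_eqF ?pi_gt0.
have [b0|b0] := leP 0 b.
  exists (acos a / (2 * pi)).
  apply: circle_eq; rewrite ?circ_expc ?circ_exps mulrC divfK //.
    by rewrite acosK.
  by rewrite sb ger0_norm.
exists (- acos a / (2 * pi)).
apply: circle_eq; rewrite ?circ_expc ?circ_exps mulrC divfK //.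
  by rewrite cosN acosK.
by rewrite sinN sb ltr0_norm // opprK.
Qed.

Lemma row_continuous (T : topologicalType) n (f : T -> 'rV[R]_n) x :
  (forall i, {for x, continuous (fun y => f y 0 i)}) -> {for x, continuous f}.
Proof.
move=> cf A [P xP PA].
have : \forall y \near x, forall i, P 0 i (f y 0 i).
  by apply: filter_forall => i; apply: cf; exact: (xP 0 i).
by apply: filterS => y Py; apply: PA => i j; rewrite ord1; exact: Py.
Qed.

Lemma circle_continuous (T : topologicalType) (f : T -> circle R) :
  continuous (fun x => set_val (f x) 0 0) ->
  continuous (fun x => set_val (f x) 0 1) -> continuous f.
Proof.
move=> c0 c1; apply/(@continuous_comp_initial _ _ _ set_val) => x.
by apply: row_continuous => i; have [->|->] := ord2 i; [exact: c0|exact: c1].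
Qed.

Lemma circle_coord_continuous i : continuous (fun z : circle R => set_val z 0 i).
Proof.
move=> x; apply: (@continuous_comp _ _ _ set_val (fun y : 'rV[R]_2 => y 0 i)).
  exact: initial_continuous.
exact: coord_continuous.
Qed.

(** The angle [a] itself may jump by integers, so continuity is checked on the
    coordinates, with the addition formulas. *)
Lemma continuous_rotate (T : topologicalType) (a b : T -> R) :
  continuous (fun x => circ_exp (a x)) -> continuous b ->
  continuous (fun x => circ_exp (a x + b x)).
Proof.
move=> ca cb.
have cf i : continuous (fun x => set_val (circ_exp (a x)) 0 i).
  exact: (continuous_compf ca (@circle_coord_continuous i)).
have c0 : continuous (fun x => cos (2 * pi * a x)).
  by under eq_fun do rewrite -circ_expc; exact: cf.
have c1 : continuous (fun x => sin (2 * pi * a x)).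
  by under eq_fun do rewrite -circ_exps; exact: cf.
have cb2 : continuous (fun x => 2 * pi * b x).
  by apply: continuous_mulf cb; exact: continuous_cstf.
have cc := continuous_compf cb2 (@continuous_cos R).
have cs := continuous_compf cb2 (@continuous_sin R).
apply: circle_continuous.
  under eq_fun do rewrite circ_expc mulrDr cosD.
  apply: continuous_addf; first exact: continuous_mulf.
  by apply: (@continuous_oppf R R^o); exact: continuous_mulf.
under eq_fun do rewrite circ_exps mulrDr sinD.
by apply: continuous_addf; exact: continuous_mulf.
Qed.

Lemma circ_exp_continuous : continuous (@circ_exp R).
Proof.
have := @continuous_rotate R (fun=> 0) id.
under [X in _ -> _ -> continuous X]eq_fun do rewrite add0r.
by apply; [exact: continuous_cstf|exact: continuous_idf].
Qed.

Lemma cos_lt_of_far (e x : R) : 0 < e -> e <= x <= 1 - e ->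
  cos (2 * pi * x) <= cos (2 * pi * e).
Proof.
move=> e0 /andP[ex xe]; have p0 := @pi_gt0 R.
have half y : e <= y -> y <= 1 / 2 -> cos (2 * pi * y) <= cos (2 * pi * e).
  move=> ey y2; have [->//|ne] := eqVneq e y.
  apply/ltW; rewrite ltr_cos ?in_itv /=; first by nra.
    by apply/andP; split; nra.
  by apply/andP; split; nra.
have [x2|x2] := leP x (1 / 2); first exact: half.
have -> : cos (2 * pi * x) = cos (2 * pi * (1 - x)).
  by rewrite mulrBr mulr1 mulr_natl cosB cos2pi sin2pi; lra.
by apply: half; lra.
Qed.

(** The angle is continuous up to an integer: the inner product with
    [circ_exp a] is the cosine of the difference of the angles, and it is close
    to 1 only if the difference is close to an integer. *)
Lemma circ_exp_near (a e : R) : 0 < e ->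
  \forall z \near circ_exp a,
    forall t, circ_exp t = z -> exists n : int, `|t - a - n%:~R| < e.
Proof.
move=> e0; wlog e1 : e e0 / e <= 1 / 2.
  move=> wl; have := wl (Order.min e (1 / 2)).
  rewrite lt_min e0 /= ge_min lexx orbT => /(_ _ isT) H.
  have {}H := H (ltac:(lra)); apply: filterS H => z zP t /zP[n nP].
  by exists n; move: nP; rewrite lt_min => /andP[].
pose g (z : circle R) := set_val z 0 0 * cos (2 * pi * a) + set_val z 0 1 * sin (2 * pi * a).
have cg : continuous g.
  by apply: continuous_addf; apply: continuous_mulf; first
    [exact: circle_coord_continuous|exact: continuous_cstf].
have gE t : g (circ_exp t) = cos (2 * pi * (t - a)).
  by rewrite /g circ_expc circ_exps mulrBr cosB.
have ga : cos (2 * pi * e) < g (circ_exp a).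
  have p0 := @pi_gt0 R.
  rewrite gE subrr mulr0 -[X in _ < cos X](mulr0 (2 * pi)) ltr_cos ?in_itv /=.
  - by nra.
  - by apply/andP; split; nra.
  - by apply/andP; split; nra.
have gn : \forall z \near circ_exp a, cos (2 * pi * e) < g z.
  exact: (cg (circ_exp a) _ (lt_nbhsr ga)).
apply: (filterS _ gn) => z gz t tz; move: gz; rewrite -tz gE => gz.
have /andP[d0 d1] := floor_itv (t - a); rewrite intrD in d1.
set n := Num.floor (t - a) in d0 d1.
have cE : cos (2 * pi * (t - a)) = cos (2 * pi * (t - a - n%:~R)).
  by rewrite -!circ_expc -[t - a](subrK n%:~R) circ_expDint subrK.
have [l1|l1] := ltP (t - a - n%:~R) e.
  by exists n; rewrite ger0_norm //; lra.
have [l2|l2] := ltP (1 - e) (t - a - n%:~R).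
  exists (n + 1); rewrite intrD ler0_norm; lra.
by move: gz; rewrite ltNge cE cos_lt_of_far ?l1.
Qed.

End CircleFacts.

(** * Heights and double lines *)

Section Heights.
Context {R : realType}.
Variable t0 : R.
Implicit Types (z : circle R) (f g : R -> R) (t h l r : R).

Lemma heightP z : 0 <= height t0 z < 1 /\ circ_exp (t0 + height t0 z) = z.
Proof.
rewrite /height; case: xgetP => [h _ [/andP[/ltW -> ->] ->] //|none].
rewrite lexx ltr01 addr0; split=> //.
have [t tz] := circ_exp_surj z.
have /andP[d0 d1] := floor_itv (t - t0); rewrite intrD in d1.
set n := Num.floor _ in d0 d1.
pose h := t - t0 - n%:~R.
have hz : circ_exp (t0 + h) = z.
  by rewrite -tz; apply/circ_expP; exists (- n); rewrite /h rmorphN /=; lra.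
have [h0|h0] := eqVneq h 0; first by rewrite -hz h0 addr0.
case: (none h); split=> //; rewrite lt_def h0 /=.
by rewrite /h; apply/andP; split; lra.
Qed.

Lemma height_ge0 z : 0 <= height t0 z.
Proof. by have [/andP[]] := heightP z. Qed.

Lemma height_lt1 z : height t0 z < 1.
Proof. by have [/andP[]] := heightP z. Qed.

Lemma circ_exp_height z : circ_exp (t0 + height t0 z) = z.
Proof. by have [] := heightP z. Qed.

Lemma height_eq0 z : height t0 z = 0 <-> z = circ_exp t0.
Proof.
split=> [h0|zt]; first by rewrite -(circ_exp_height z) h0 addr0.
have /circ_expP[n] : circ_exp (t0 + height t0 z) = circ_exp t0.
  by rewrite circ_exp_height.
move=> /(addrI t0) hn.
have n1 : n < 1 by rewrite -(ltr_int R) -hn height_lt1.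
have n0 : 0 <= n by rewrite -(ler_int R) -hn height_ge0.
by rewrite hn (_ : n = 0) //; apply/eqP; rewrite eq_le n0 -ltzD1 add0r n1.
Qed.

Lemma height_continuous z : z <> circ_exp t0 -> {for z, continuous (height t0)}.
Proof.
move=> zt; set h := height t0 z.
have h0 : 0 < h.
  by rewrite lt_def height_ge0 andbT; apply/eqP => /height_eq0.
have h1 : h < 1 by exact: height_lt1.
rewrite -/h in h0 h1 *.
have zF : Filter (nbhs z) by exact: nbhs_filter.
apply/(@cvgrPdist_lt _ _ _ _ zF) => e e0.
pose d := Order.min e (Order.min h (1 - h)).
have d0 : 0 < d by rewrite !lt_min e0 h0 subr_gt0.
have := circ_exp_near (t0 + h) d0; rewrite circ_exp_height.
apply: filterS => w /(_ _ (circ_exp_height w)) [n].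
rewrite !lt_min !ltr_norml => /and3P[].
have := height_ge0 w; have := height_lt1 w; set h' := height t0 w.
move=> h'1 h'0 /andP[a1 a2] /andP[b1 b2] /andP[c1 c2].
have n0 : n = 0.
  apply/eqP; rewrite eq_le -!ltzD1 -!(ltr_int R) /= !intrD.
  by apply/andP; split; lra.
move: a1 a2; rewrite n0 subr0 => a1 a2.
by rewrite -/h -/h'; apply/andP; split; lra.
Qed.

(** The one-sided limits are measured from the value [f t]: the jumps of a sum
    then add up, and a sum whose jumps cancel is continuous. *)
Definition has_jump f t l r :=
  (f x @[x --> t^'-] --> f t + l) /\ (f x @[x --> t^'+] --> f t + r).

Lemma jump_continuous f t : has_jump f t 0 0 -> {for t, continuous f}.
Proof. by rewrite /has_jump addr0 => H; exact/left_right_continuousP. Qed.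

Lemma continuous_jump f t : {for t, continuous f} -> has_jump f t 0 0.
Proof. by move=> H; rewrite /has_jump addr0; exact/left_right_continuousP. Qed.

Lemma jumpD f g t l r l' r' : has_jump f t l r -> has_jump g t l' r' ->
  has_jump (fun x => f x + g x) t (l + l') (r + r').
Proof. by move=> [fl fr] [gl gr]; split; rewrite addrACA; exact: cvgD. Qed.

Lemma jumpB f g t l r l' r' : has_jump f t l r -> has_jump g t l' r' ->
  has_jump (fun x => f x - g x) t (l - l') (r - r').
Proof. by move=> [fl fr] [gl gr]; split; rewrite addrACA -opprD; exact: cvgB. Qed.

Lemma at_left_comp (r : R -> R) t : {for t, continuous r} ->
  (\forall x \near t^'-, r x < r t) -> r x @[x --> t^'-] --> (r t)^'-.
Proof.
move=> cr rt A rA.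
have cA : \forall x \near t, r x < r t -> A (r x).
  exact: (cr [set y | y < r t -> A y] rA).
have cA' : \forall x \near t^'-, r x < r t -> A (r x).
  by apply: filterS cA => x + _.
by apply: filterS2 rt cA' => x xt; exact.
Qed.

Lemma at_right_comp (r : R -> R) t : {for t, continuous r} ->
  (\forall x \near t^'+, r t < r x) -> r x @[x --> t^'+] --> (r t)^'+.
Proof.
move=> cr rt A rA.
have cA : \forall x \near t, r t < r x -> A (r x).
  exact: (cr [set y | r t < y -> A y] rA).
have cA' : \forall x \near t^'+, r t < r x -> A (r x).
  by apply: filterS cA => x + _.
by apply: filterS2 rt cA' => x xt; exact.
Qed.

Lemma jump_comp f (r : R -> R) t a b : {for t, continuous r} ->
  (\forall x \near t^'-, r x < r t) -> (\forall x \near t^'+, r t < r x) ->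
  has_jump f (r t) a b -> has_jump (f \o r) t a b.
Proof.
move=> cr rl rr [fl fr]; split.
  by apply: (cvg_comp _ _ _ fl); exact: at_left_comp.
by apply: (cvg_comp _ _ _ fr); exact: at_right_comp.
Qed.

Lemma periodic_jump f t (n : int) a b : (forall u, f (u + n%:~R) = f u) ->
  has_jump f (t + n%:~R) a b -> has_jump f t a b.
Proof.
move=> fn H; have := @jump_comp f (fun u => u + n%:~R) t a b.
rewrite (_ : f \o _ = f); last by apply/funext => u /=.
apply=> //.
- by apply: cvgD; [exact: cvg_id|exact: cvg_cst].
- by near=> u; rewrite ltrD2r; near: u; exact: nbhs_left_lt.
- by near=> u; rewrite ltrD2r; near: u; exact: nbhs_right_gt.
Unshelve. all: end_near. Qed.

Lemma derive1_gt0_near f t : derivable f t 1 -> 0 < derive1 f t ->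
  (\forall x \near t^'-, f x < f t) /\ (\forall x \near t^'+, f t < f x).
Proof.
move=> df f0.
rewrite derive1E in f0.
have dl : \forall h \near 0^', 0 < h^-1 * (f (h + t) - f t).
  have : \forall h \near 0^', 0 < h^-1 *: ((f \o shift t) (h *: 1) - f t).
    exact: (df _ (lt_nbhsr f0)).
  by apply: filterS => h; rewrite /= [_ *: 1]mulr1.
have dt : \forall x \near t, x != t -> 0 < (x - t)^-1 * (f x - f t).
  apply/nbhs0P; apply: filterS (dl : \forall h \near 0, h != 0 -> _) => h H ht.
  rewrite (addrC t h) addrK H //; apply: contra_neq ht => ->.
  by rewrite addr0.
have dtl : \forall x \near t^'-, x != t -> 0 < (x - t)^-1 * (f x - f t).
  by apply: filterS dt => x + _.
have dtr : \forall x \near t^'+, x != t -> 0 < (x - t)^-1 * (f x - f t).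
  by apply: filterS dt => x + _.
split; near=> x.
  have xt : x < t by near: x; exact: nbhs_left_lt.
  have : x != t -> 0 < (x - t)^-1 * (f x - f t) by near: x.
  by rewrite lt_eqF // => /(_ isT); rewrite nmulr_rgt0 ?invr_lt0 ?subr_lt0.
have xt : t < x by near: x; exact: nbhs_right_gt.
have : x != t -> 0 < (x - t)^-1 * (f x - f t) by near: x.
by rewrite gt_eqF // => /(_ isT); rewrite pmulr_rgt0 ?invr_gt0 ?subr_gt0.
Unshelve. all: end_near. Qed.

End Heights.

Section KnotHeights.
Context {R : realType} (S : surface R).
Variables (t0 : R) (K : knot_map S).

Definition knot_height (t : R) : R := height t0 (K (circ_exp t)).2.

Lemma knot_heightE t : circ_exp (t0 + knot_height t) = (K (circ_exp t)).2.
Proof. exact: circ_exp_height. Qed.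

Lemma knot_heightD t (n : int) : knot_height (t + n%:~R) = knot_height t.
Proof. by rewrite /knot_height circ_expDint. Qed.

Hypothesis knotK : is_knot K.

Lemma knot_circ_continuous : continuous (fun t : R => (K (circ_exp t)).2).
Proof.
have [_ _ sm _] := knotK.
apply: circle_continuous => t.
  exact: (proj1 (sm 0 0%N) t I).
exact: (proj1 (sm 1 0%N) t I).
Qed.

Lemma knot_surf_continuous : continuous (fun t : R => (K (circ_exp t)).1).
Proof. by have [_ [cs _] _ _] := knotK; move=> t; exact: cs. Qed.

Lemma knot_continuous : continuous (fun t : R => K (circ_exp t)).
Proof.
have := continuous_pairf knot_surf_continuous knot_circ_continuous.
by under [X in continuous X -> _]eq_fun do rewrite -surjective_pairing.
Qed.

Lemma knot_coord_derivable i (t : R) :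
  derivable (fun u : R => set_val (K (circ_exp u)).2 0 i) t 1.
Proof.
have [_ _ sm _] := knotK.
by have [_ /(_ 1)[d _]] := sm i 1%N; exact: d.
Qed.

Lemma sin_ge0_half (h : R) : 0 <= h <= 1 / 2 -> 0 <= sin (2 * pi * h).
Proof.
move=> /andP[h0 h1]; have p0 := @pi_gt0 R.
by apply: sin_ge0_pi; apply/andP; split; nra.
Qed.

Lemma sin_le0_half (h : R) : 1 / 2 <= h <= 1 -> sin (2 * pi * h) <= 0.
Proof.
move=> /andP[h0 h1]; have p0 := @pi_gt0 R.
rewrite (_ : 2 * pi * h = 2 * pi * (h - 1 / 2) + pi); last by field.
by rewrite sinDpi oppr_le0 sin_ge0_half //; apply/andP; split; lra.
Qed.

(** Near a point over the base point, the sign of the sine of the angle tells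
    on which side of the base point the knot is. *)
Lemma knot_height_near t e : 0 < e -> (K (circ_exp t)).2 = circ_exp t0 ->
  \forall x \near t,
    (0 < sin (2 * pi * knot_height x) -> `|knot_height x| < e) /\
    (sin (2 * pi * knot_height x) < 0 -> `|1 - knot_height x| < e).
Proof.
move=> e0 Kt; pose d := Order.min e (1 / 2).
have d0 : 0 < d by rewrite lt_min e0 divr_gt0.
have zn := circ_exp_near t0 d0; rewrite -Kt in zn.
have cn : \forall x \near t, forall u, circ_exp u = (K (circ_exp x)).2 ->
    exists n : int, `|u - t0 - n%:~R| < d by exact: (@knot_circ_continuous t _ zn).
apply: filterS cn => x /(_ _ (knot_heightE x)) [n].
rewrite (addrC t0) addrK.
have := height_ge0 t0 (K (circ_exp x)).2; have := height_lt1 t0 (K (circ_exp x)).2.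
rewrite -/(knot_height x) lt_min; set h := knot_height x.
rewrite !ltr_norml => h1 h0 /andP[/andP[a1 a2] /andP[b1 b2]].
have nE (m : int) : m%:~R - 1 < n%:~R :> R -> n%:~R < m%:~R + 1 :> R -> n = m.
  rewrite -[1]/(1%:~R) -intrB -intrD !ltr_int => c1 c2; apply/eqP.
  by rewrite eq_le -ltzD1 c2 -ltzD1 -ltrBlDr c1.
split=> sh.
  have h2 : h < 1 / 2.
    rewrite ltNge; apply/negP => h2; have : sin (2 * pi * h) <= 0.
      by apply: sin_le0_half; rewrite h2 ltW.
    by rewrite leNgt sh.
  have n0 : n = 0 by apply: nE; lra.
  by move: a1 a2; rewrite n0; lra.
have h2 : 1 / 2 < h.
  rewrite ltNge; apply/negP => h2; have : 0 <= sin (2 * pi * h).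
    by apply: sin_ge0_half; rewrite h2 h0.
  by rewrite leNgt sh.
have n0 : n = 1 by apply: nE; lra.
by move: a1 a2; rewrite n0; lra.
Qed.

Lemma knot_height_cvg t (F : set_system R) : Filter F -> F `=>` nbhs t ->
  (K (circ_exp t)).2 = circ_exp t0 ->
  ((\forall x \near F, 0 < sin (2 * pi * knot_height x)) ->
    knot_height x @[x --> F] --> (0 : R)) /\
  ((\forall x \near F, sin (2 * pi * knot_height x) < 0) ->
    knot_height x @[x --> F] --> (1 : R)).
Proof.
move=> FF Ft Kt; split=> sg; apply/cvgrPdist_lt => e e0.
  apply: filterS2 sg (Ft _ (knot_height_near e0 Kt)) => x sx [+ _].
  by rewrite sub0r normrN; apply.
by apply: filterS2 sg (Ft _ (knot_height_near e0 Kt)) => x sx [_]; apply.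
Qed.

(** The velocity at the base point is tangent to the circle and nonzero, so the
    sine of the angle, measured from the base point, changes sign there and the
    height jumps. *)
Lemma base_crossing_marked t :
  (K (circ_exp t)).2 = circ_exp t0 -> derive1 (circ_part K) t != 0 ->
  marks (diagram_of t0 K) (circ_exp t).
Proof.
move=> Kt dK.
pose a i (u : R) : R := set_val (K (circ_exp u)).2 0 i.
have da i : derivable (a i : R^o -> R^o) t 1 by exact: knot_coord_derivable.
have aa u : a 0 u ^+ 2 + a 1 u ^+ 2 = 1.
  by have := set_mem (valP (K (circ_exp u)).2); rewrite -!set_valE.
pose c := cos (2 * pi * t0); pose s := sin (2 * pi * t0).
have a0t : a 0 t = c by rewrite /a Kt circ_expc.
have a1t : a 1 t = s by rewrite /a Kt circ_exps.
pose d i : R := 'D_1 (a i : R^o -> R^o) t.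
have ida i : is_derive (t : R^o) 1 (a i : R^o -> R^o) (d i) by exact: DeriveDef.
have tangent : c * d 0 + s * d 1 = 0.
  have := is_deriveD (is_deriveM (ida 0) (ida 0)) (is_deriveM (ida 1) (ida 1)).
  rewrite (_ : _ + _ = cst 1) => [[_]|]; last first.
    by apply/funext => u; rewrite -(aa u) !expr2.
  by rewrite derive_cst a0t a1t /GRing.scale /=; lra.
pose g (u : R) : R := c * a 1 u - s * a 0 u.
have gE u : g u = sin (2 * pi * knot_height u).
  rewrite /g /a -knot_heightE circ_expc circ_exps.
  have -> : 2 * pi * (t0 + knot_height u) = 2 * pi * t0 + 2 * pi * knot_height u.
    by rewrite mulrDr.
  rewrite sinD cosD -/c -/s.
  have cs : c ^+ 2 + s ^+ 2 = 1 by exact: cos2Dsin2.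
  set x := sin _; set y := cos _.
  transitivity (x * (c ^+ 2 + s ^+ 2)); first by ring.
  by rewrite cs mulr1.
have gt : g t = 0 by rewrite /g a0t a1t; ring.
have idg : is_derive (t : R^o) 1 (g : R^o -> R^o) (c * d 1 - s * d 0).
  exact: (is_deriveB (is_deriveZ c (ida 1)) (is_deriveZ s (ida 0))).
have g' : derive1 (g : R^o -> R^o) t = c * d 1 - s * d 0.
  by rewrite derive1E derive_val.
have dg : derivable (g : R^o -> R^o) t 1 by exact: ex_derive.
have g0 : c * d 1 - s * d 0 != 0.
  apply: contra dK => /eqP g0.
  have cs : c ^+ 2 + s ^+ 2 = 1 by exact: cos2Dsin2.
  have d0 : d 0 = 0.
    transitivity ((c ^+ 2 + s ^+ 2) * d 0); first by rewrite cs mul1r.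
    transitivity (c * (c * d 0 + s * d 1) - s * (c * d 1 - s * d 0)); first by ring.
    by rewrite tangent g0; ring.
  have d1 : d 1 = 0.
    transitivity ((c ^+ 2 + s ^+ 2) * d 1); first by rewrite cs mul1r.
    transitivity (s * (c * d 0 + s * d 1) + c * (c * d 1 - s * d 0)); first by ring.
    by rewrite tangent g0; ring.
  rewrite derive1E derive_mx; last first.
    by apply/derivable_mxP => i j; rewrite ord1; exact: da.
  apply/eqP/rowP => i; rewrite !mxE.
  by have [->|->] := ord2 i; [exact: d0|exact: d1].
have [Fl Fr] : t^'- `=>` nbhs t /\ t^'+ `=>` nbhs t.
  by split=> A; apply: filterS => x + _.
have [cl0 cl1] := @knot_height_cvg t _ _ Fl Kt.
have [cr0 cr1] := @knot_height_cvg t _ _ Fr Kt.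
have [gp|gn|g0'] := ltgtP 0 (c * d 1 - s * d 0).
- have [nl nr] := derive1_gt0_near dg (eq_ind_r (fun x => 0 < x) gp g').
  left; split=> //; exists t => //; split.
    by apply: cl1; apply: filterS nl => x; rewrite gt gE.
  by apply: cr0; apply: filterS nr => x; rewrite gt gE.
- have dgN : derivable (- (g : R^o -> R^o)) t 1 by exact: derivableN.
  have [|nl nr] := @derive1_gt0_near _ _ t dgN.
    by rewrite derive1E deriveN // -derive1E g' oppr_gt0.
  right; split=> //; exists t => //; split.
    apply: cl0; apply: filterS nl => x nx; have : - g x < - g t by [].
    by rewrite ltrN2 gt gE.
  apply: cr1; apply: filterS nr => x nx; have : - g t < - g x by [].
  by rewrite ltrN2 gt gE.
- by rewrite -g0' eqxx in g0.
Qed.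

Lemma knot_height_base t : (K (circ_exp t)).2 = circ_exp t0 -> knot_height t = 0.
Proof. by move=> Kt; apply/height_eq0. Qed.

(** The height takes the value 0 at the base point, so the jump of an [up] line
    is on its left and that of a [down] line on its right. *)
Lemma up_jump t : up (diagram_of t0 K) (circ_exp t) -> has_jump knot_height t 1 0.
Proof.
move=> [Kt [u /esym/circ_expP[n tE] [ul ur]]].
apply: (@periodic_jump _ _ _ (- n)); first by move=> v; exact: knot_heightD.
rewrite /has_jump rmorphN /= tE addrK !knot_height_base ?add0r //.
by rewrite -Kt tE circ_expDint.
Qed.

Lemma down_jump t : down (diagram_of t0 K) (circ_exp t) -> has_jump knot_height t 0 1.
Proof.
move=> [Kt [u /esym/circ_expP[n tE] [ul ur]]].
apply: (@periodic_jump _ _ _ (- n)); first by move=> v; exact: knot_heightD.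
rewrite /has_jump rmorphN /= tE addrK !knot_height_base ?add0r //.
by rewrite -Kt tE circ_expDint.
Qed.

Hypothesis genK : general_position t0 K.

Lemma unmarked_off_base t : ~ marks (diagram_of t0 K) (circ_exp t) ->
  (K (circ_exp t)).2 <> circ_exp t0.
Proof.
by have [tr _ _ _ _] := genK; move=> mt Kt; apply: mt; apply: base_crossing_marked (tr _ Kt).
Qed.

Lemma unmarked_continuous t : ~ marks (diagram_of t0 K) (circ_exp t) ->
  {for t, continuous knot_height}.
Proof.
move=> /unmarked_off_base Kt.
apply: (@continuous_comp _ _ _ (fun t => (K (circ_exp t)).2) (height t0)).
  exact: knot_circ_continuous.
exact: height_continuous.
Qed.

Lemma unmarked_jump t : ~ marks (diagram_of t0 K) (circ_exp t) ->
  has_jump knot_height t 0 0.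
Proof. by move=> /unmarked_continuous; exact: continuous_jump. Qed.

End KnotHeights.

(** * The height difference of two knots *)

Section ArcIndicator.
Context {R : realType}.
Variables x y : R.
Hypotheses (xy : x < y) (yx : y < x + 1).

Definition arc_indicator (t : R) : R := `[< arc x y (circ_exp t) >]%:R.

Lemma arc_indicatorD t (n : int) : arc_indicator (t + n%:~R) = arc_indicator t.
Proof. by rewrite /arc_indicator circ_expDint. Qed.

Lemma arc_indicator1 t : x <= t <= y -> arc_indicator t = 1.
Proof.
move=> txy; rewrite /arc_indicator asboolT //; exists t => //=.
Qed.

Lemma arc_indicator0 t : y < t < x + 1 -> arc_indicator t = 0.
Proof.
move=> /andP[yt tx]; rewrite /arc_indicator asboolF // => -[u /=].
rewrite in_itv /= => /andP[xu uy] /circ_expP[n un].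
have n0 : n < 0 by rewrite -(ltr_int R); lra.
have n1 : -1 < n by rewrite -(ltr_int R); lra.
by lia.
Qed.

(** The arc is closed, so the indicator jumps on the left of [x] and on the right
    of [y].  These jumps compensate those of the height at an [up] line placed at
    [x] and at a [down] line placed at [y]. *)
Lemma arc_indicator_jump t : has_jump arc_indicator t
  (- `[< circ_exp t = circ_exp x >]%:R) (- `[< circ_exp t = circ_exp y >]%:R).
Proof.
wlog /andP[xt tx] : t / x <= t < x + 1.
  move=> wl; pose n := - Num.floor (t - x).
  have /andP[d0 d1] := floor_itv (t - x); rewrite intrD in d1.
  apply: (@periodic_jump _ _ _ n); first by move=> v; exact: arc_indicatorD.
  rewrite -(circ_expDint t n); apply: wl.
  by rewrite /n rmorphN /=; apply/andP; split; lra.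
have cst1 (F : set_system R) : Filter F -> (\forall u \near F, x <= u <= y) ->
    arc_indicator u @[u --> F] --> (1 : R).
  by move=> FF H; apply: cvg_near_cst; apply: filterS H => u /arc_indicator1.
have cst0 (F : set_system R) : Filter F -> (\forall u \near F, y < u < x + 1) ->
    arc_indicator u @[u --> F] --> (0 : R).
  by move=> FF H; apply: cvg_near_cst; apply: filterS H => u /arc_indicator0.
have inj u v : x <= u < x + 1 -> x <= v < x + 1 ->
    (circ_exp u = circ_exp v) = (u = v).
  move=> /andP[xu ux] /andP[xv vx]; rewrite propeqE; split=> [/circ_expP[n un]|->//].
  have n0 : n < 1 by rewrite -(ltr_int R); lra.
  have n1 : -1 < n by rewrite -(ltr_int R); lra.
  have n00 : n = 0 by lia.
  by rewrite un n00 addr0.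
have xx : x <= x < x + 1 by rewrite lexx ltrDl ltr01.
have yy : x <= y < x + 1 by rewrite (ltW xy).
rewrite !inj ?xt //.
have [tx0|tx0] := eqVneq t x.
  rewrite tx0 asboolT // asboolF; last by move=> e; move: xy; rewrite e ltxx.
  rewrite /has_jump arc_indicator1 ?lexx ?(ltW xy) // subrr oppr0 addr0; split.
    apply: cvg_near_cst; near=> u.
    rewrite -(arc_indicatorD u 1) arc_indicator0 // mulr1z ltrD2r.
    apply/andP; split; last by near: u; exact: nbhs_left_lt.
    by rewrite -ltrBlDr; near: u; apply: nbhs_left_gt; rewrite ltrBlDr.
  apply: cst1; near=> u; apply/andP; split.
    by near: u; exact: nbhs_right_ge.
  by near: u; exact: nbhs_right_le.
rewrite (asboolF (P := t = x)) ?oppr0; last exact/eqP.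
have xt' : x < t by rewrite lt_neqAle eq_sym tx0.
have [ty|ty|ty] := ltgtP t y.
- rewrite asboolF ?oppr0; last by move=> e; rewrite e ltxx in ty.
  apply: continuous_jump; rewrite /prop_for /continuous_at arc_indicator1 ?xt ?(ltW ty) //.
  apply: cst1; near=> u; apply/andP; split.
    by apply/ltW; near: u; exact: lt_nbhsr.
  by apply/ltW; near: u; exact: lt_nbhsl.
- rewrite asboolF ?oppr0; last by move=> e; rewrite e ltxx in ty.
  apply: continuous_jump; rewrite /prop_for /continuous_at arc_indicator0 ?ty ?tx //.
  apply: cst0; near=> u; apply/andP; split.
    by near: u; exact: lt_nbhsr.
  by near: u; exact: lt_nbhsl.
rewrite ty asboolT // /has_jump arc_indicator1 ?lexx ?(ltW xy) // addr0 subrr; split.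
  apply: cst1; near=> u; apply/andP; split.
    by near: u; exact: nbhs_left_ge.
  by near: u; exact: nbhs_left_le.
apply: cst0; near=> u; apply/andP; split.
  by near: u; exact: nbhs_right_gt.
by near: u; exact: nbhs_right_lt.
Unshelve. all: end_near. Qed.

End ArcIndicator.

Section HeightDifference.
Context {R : realType} (S : surface R).
Variables (t0 : R) (K K' : knot_map S).
Hypotheses (knotK : is_knot K) (knotK' : is_knot K').
Hypotheses (genK : general_position t0 K) (genK' : general_position t0 K').
Local Notation D := (diagram_of t0 K).
Local Notation D' := (diagram_of t0 K').

(** At a common double line both heights jump in the same way, and elsewhere both
    are continuous. *)
Lemma continuous_height_difference (r : R -> R) :
  continuous r -> (forall t, \forall x \near t^'-, r x < r t) ->
  (forall t, \forall x \near t^'+, r t < r x) ->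
  (forall t, up D' (circ_exp (r t)) <-> up D (circ_exp t)) ->
  (forall t, down D' (circ_exp (r t)) <-> down D (circ_exp t)) ->
  continuous (fun t => knot_height t0 K' (r t) - knot_height t0 K t).
Proof.
move=> cr rl rr upE downE t; apply: jump_continuous.
have jr a b : has_jump (knot_height t0 K') (r t) a b ->
    has_jump (knot_height t0 K' \o r) t a b.
  by apply: jump_comp; [exact: cr|exact: rl|exact: rr].
have [u|u] := pselect (up D (circ_exp t)).
  have := jumpB (jr _ _ (up_jump ((upE t).2 u))) (up_jump u).
  by rewrite !subrr.
have [d|d] := pselect (down D (circ_exp t)).
  have := jumpB (jr _ _ (down_jump ((downE t).2 d))) (down_jump d).
  by rewrite !subrr.
have := jumpB (jr _ _ (unmarked_jump knotK' genK' (t := r t) _))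
              (unmarked_jump knotK genK (t := t) _).
rewrite !subrr; apply; first by case=> [/upE|/downE].
by case.
Qed.

(** The arc between the new double lines has been lifted by a full turn, while
    its height is read modulo 1. *)
Lemma continuous_height_push x y : x < y -> y < x + 1 ->
  ~ marks D (circ_exp x) -> ~ marks D (circ_exp y) ->
  up D' = up D `|` [set circ_exp x] -> down D' = down D `|` [set circ_exp y] ->
  continuous (fun t => knot_height t0 K' t + arc_indicator x y t - knot_height t0 K t).
Proof.
move=> xy yx mx my upE downE t; apply: jump_continuous.
have je := arc_indicator_jump xy yx t.
have xNy : circ_exp x <> circ_exp y :> circle R.
  move=> /circ_expP[n xyn].
  have n0 : n < 0 by rewrite -(ltr_int R); lra.
  have n1 : -1 < n by rewrite -(ltr_int R); lra.
  by lia.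
have [tx|tx] := pselect (circ_exp t = circ_exp x).
  have u' : up D' (circ_exp t) by rewrite upE; right.
  have m : ~ marks D (circ_exp t) by rewrite tx.
  have := jumpB (jumpD (up_jump u') je) (unmarked_jump knotK genK m).
  rewrite asboolT // asboolF; last by rewrite tx.
  by rewrite !(oppr0, subrr, addr0).
have [ty|ty] := pselect (circ_exp t = circ_exp y).
  have d' : down D' (circ_exp t) by rewrite downE; right.
  have m : ~ marks D (circ_exp t) by rewrite ty.
  have := jumpB (jumpD (down_jump d') je) (unmarked_jump knotK genK m).
  rewrite asboolF; last by rewrite ty; exact/nesym.
  by rewrite asboolT // !(oppr0, subrr, addr0).
rewrite !asboolF // oppr0 in je.
have [u|u] := pselect (up D (circ_exp t)).
  have u' : up D' (circ_exp t) by rewrite upE; left.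
  by have := jumpB (jumpD (up_jump u') je) (up_jump u); rewrite !addr0 !subrr.
have [d|d] := pselect (down D (circ_exp t)).
  have d' : down D' (circ_exp t) by rewrite downE; left.
  by have := jumpB (jumpD (down_jump d') je) (down_jump d); rewrite !addr0 !subrr.
have m : ~ marks D (circ_exp t) by case.
have m' : ~ marks D' (circ_exp t).
  by case; rewrite ?upE ?downE => -[].
have := jumpB (jumpD (unmarked_jump knotK' genK' m') je) (unmarked_jump knotK genK m).
by rewrite !addr0 !subrr.
Qed.
End HeightDifference.

(** * Comparison of two knots along a homotopy *)

Section Comparison.
Context {R : realType} (S : surface R).
Variables (t0 : R) (k : chain (R := R) (S * circle R)%type 1).
Implicit Types (K : knot_map S) (p : S).
Local Notation arc_class := (arc_class k).

Definition fiber_path p (h : R) : S * circle R := (p, circ_exp (t0 + h)).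

Lemma fiber_path_continuous p : continuous (fiber_path p).
Proof.
apply: continuous_pairf; first exact: continuous_cstf.
apply: (continuous_compf _ (@circ_exp_continuous R)).
by apply: continuous_addf; [exact: continuous_cstf|exact: continuous_idf].
Qed.

Definition knot_path K (t : R) : S * circle R := K (circ_exp t).

(** If [x] and [y] are the parameters of a crossing, this is the class of its
    closed curve; the formula makes sense for any two parameters. *)
Definition double_point_class K (x y : R) :=
  arc_class (fiber_path (K (circ_exp x)).1) (knot_height t0 K x) (knot_height t0 K y)
  + arc_class (knot_path K) y x.

(** A homotopy [Sig] of the projections and a continuous lift
    [h' \o r + e - h] of the difference of the heights, where [e] takes integer
    values, give a homotopy from [K] to a reparametrisation of [K']. *)
Section Homotopy.
Variables (K K' : knot_map S) (Sig : R -> R -> S) (r e : R -> R).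
Let h := knot_height t0 K.
Let lift t := knot_height t0 K' (r t).
Hypotheses (knotK : is_knot K) (knotK' : is_knot K').
Hypotheses (cS : continuous (fun p : R * R => Sig p.1 p.2)) (cr : continuous r).
Hypotheses (S0 : forall t, Sig 0 t = (K (circ_exp t)).1)
  (S1 : forall t, Sig 1 t = (K' (circ_exp (r t))).1).
Hypotheses (cd : continuous (fun t => lift t + e t - h t))
  (eE : forall t, circ_exp (t0 + (lift t + e t)) = (K' (circ_exp (r t))).2).

(** The term [t0 + h t] alone is discontinuous at the double lines; it is only
    used through [circ_exp], where it gives the circle coordinate of [K]. *)
Definition homotopy_track t (u : R) : S * circle R :=
  (Sig u t, circ_exp (t0 + h t + u * (lift t + e t - h t))).

Lemma knot_arc_homotopy x y :
  arc_class (knot_path K') (r y) (r x) = arc_class (knot_path K) y x +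
  (arc_class (homotopy_track x) 0 1 - arc_class (homotopy_track y) 0 1).
Proof.
pose H (u t : R) := homotopy_track t u.
have cH : continuous (fun p : R * R => H p.1 p.2).
  apply: continuous_pairf; first exact: cS.
  apply: (@continuous_rotate R _ (fun q : R * R => t0 + h q.2)
    (fun q : R * R => q.1 * (lift q.2 + e q.2 - h q.2))).
    under eq_fun do rewrite knot_heightE.
    exact: (continuous_compf (@continuous_sndf R R) (knot_circ_continuous knotK)).
  apply: continuous_mulf; first exact: continuous_fstf.
  exact: (continuous_compf (@continuous_sndf R R) cd).
have H1 : arc_class (H 1) y x = arc_class (knot_path K') (r y) (r x).
  rewrite -arc_class_reparam //; last exact: knot_continuous.
  congr arc_class; apply/funext => t; rewrite /H /homotopy_track /= /knot_path S1.
  by rewrite mul1r -addrA (addrC (h t)) subrK eE -surjective_pairing.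
have H0 : arc_class (H 0) y x = arc_class (knot_path K) y x.
  congr arc_class; apply/funext => t; rewrite /H /homotopy_track /= /knot_path S0.
  by rewrite mul0r addr0 knot_heightE -surjective_pairing.
have := homotopy_class k y x cH; rewrite H0 H1 => /eqP.
by rewrite subr_eq addrC => /eqP.
Qed.

Lemma stationary_track t : (forall u, Sig u t = Sig 0 t) ->
  arc_class (homotopy_track t) 0 1 =
  arc_class (fiber_path (K (circ_exp t)).1) (h t) (lift t + e t).
Proof.
move=> St; apply: arc_class_ext => u _; rewrite /homotopy_track St S0 /fiber_path.
by rewrite subr0 add0r mulr1 addrA.
Qed.

(** The two tracks and the two vertical segments are the sides of a
    quadrilateral in the image of the plane of [(u, h)], except that the upper side runs
    between the lifts, at distance [e] from the heights of [K']. *)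
Lemma double_point_class_homotopy x y : (forall u, Sig u x = Sig u y) ->
  let s := (K' (circ_exp (r x))).1 in
  double_point_class K' (r x) (r y) =
  double_point_class K x y + (arc_class (fiber_path s) (lift x) (lift x + e x)
   - arc_class (fiber_path s) (lift y) (lift y + e y)).
Proof.
move=> Sxy s.
pose E (q : R^o * R^o) : S * circle R := (Sig q.1 x, circ_exp (t0 + q.2)).
have cE : continuous E.
  apply: continuous_pairf.
    apply: (@continuous_compf _ _ _ (fun q : R * R => (q.1, x)) _ _ cS).
    by apply: continuous_pairf; [exact: continuous_fstf|exact: continuous_cstf].
  apply: (continuous_compf _ (@circ_exp_continuous R)).
  by apply: continuous_addf; [exact: continuous_cstf|exact: continuous_sndf].
pose phi q := segment_class k E 0 q.
have segE a b : segment_class k E a b = phi b - phi a.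
  by apply/eqP; rewrite eq_sym subr_eq addrC segment_classD.
have fibE u p a b : p = Sig u x ->
    arc_class (fiber_path p) a b = phi (u, b) - phi (u, a).
  move=> ->; rewrite -segE; apply: path_class_ext => v _.
  by rewrite /E /fiber_path /= subrr scaler0 addr0.
have trE t : (forall u, Sig u t = Sig u x) ->
    arc_class (homotopy_track t) 0 1 = phi (1, lift t + e t) - phi (0, h t).
  move=> St; rewrite -segE; apply: path_class_ext => v _.
  rewrite /homotopy_track /E /= St; congr (_, circ_exp _).
  by rewrite subr0 add0r [v *: 1]mulr1 -addrA.
have sE : s = Sig 1 x by rewrite S1.
rewrite /double_point_class -/s !(fibE 1 s) ?(fibE 0 (K (circ_exp x)).1) ?S0 //.
rewrite knot_arc_homotopy !trE // -/h -/(lift x) -/(lift y).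
have regroup (V : zmodType) (a b c f g m n : V) :
    g - f + (a + (b - m - (c - n))) = n - m + a + (b - f - (c - g)).
  by rewrite !opprB !addrA [LHS](ACl (6*5*3*4*2*1*7))%AC.
exact: regroup.
Qed.

End Homotopy.

Lemma double_point_classN K x y : is_knot K ->
  (K (circ_exp x)).1 = (K (circ_exp y)).1 ->
  double_point_class K y x = - double_point_class K x y.
Proof.
move=> knotK xy; rewrite /double_point_class opprD -xy arc_classN.
  by congr (_ + _); rewrite arc_classN //; exact: knot_continuous.
exact: fiber_path_continuous.
Qed.

End Comparison.

(** * The parity class in the quotient of the chains *)

Lemma continuous_paste_le (R : realType) (X : topologicalType) (a : R) (f g : R -> X) :
  continuous f -> continuous g -> f a = g a ->
  continuous (fun u => if u <= a then f u else g u).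
Proof.
move=> cf cg fga u.
have [ua|au|->] := ltgtP u a.
- rewrite /continuous_at (ltW ua).
  apply: (cvg_trans _ (cf u)); apply: near_eq_cvg.
  by near=> v; rewrite ifT //; apply/ltW; near: v; exact: lt_nbhsl.
- rewrite /continuous_at leNgt au /=.
  apply: (cvg_trans _ (cg u)); apply: near_eq_cvg.
  by near=> v; rewrite leNgt ifF //; apply/negbF; near: v; exact: lt_nbhsr.
rewrite /continuous_at lexx => A fA.
have gA : nbhs (g a) A by rewrite -fga.
have nf : \forall v \near a, A (f v) by exact: cf.
have ng : \forall v \near a, A (g v) by exact: cg.
apply: (filterS2 _ _ nf ng) => v fv gv.
by rewrite /=; case: ifP.
Unshelve. all: end_near. Qed.

Section ParityClass.
Context {R : realType} (S : surface R).
Variables (t0 : R) (K0 : knot_map S).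
Hypothesis knotK0 : is_knot K0.
Local Notation k := (path_chain (knot_path K0)).
Local Notation arc_class := (arc_class k).
Local Notation double_point_class := (double_point_class t0 k).
Implicit Types (K : knot_map S) (D : diagram S).

Lemma knot_path_continuous K : is_knot K -> continuous (knot_path K).
Proof. exact: knot_continuous. Qed.

Lemma knot_pathD K t (n : int) : knot_path K (t + n%:~R) = knot_path K t.
Proof. by rewrite /knot_path circ_expDint. Qed.

Lemma knot_path01 K : knot_path K 0 = knot_path K 1.
Proof. by rewrite -[1]add0r (knot_pathD K 0 1). Qed.

(** An isotopy is a free homotopy of loops, whose two end tracks coincide. *)
Lemma isotopic_class K : isotopic K0 K -> arc_class (knot_path K) 0 1 = 0.
Proof.
move=> [F [F0 F1 knotF [cF1 _] sF2]].
pose H (u t : R) := F u (circ_exp t).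
have cH : continuous (fun p : R * R => H p.1 p.2).
  have c1 : continuous (fun p : R * R => (H p.1 p.2).1).
    by move=> p; exact: (cF1 p I).
  have c2 : continuous (fun p : R * R => (H p.1 p.2).2).
    apply: circle_continuous => p; first exact: (proj1 (sF2 0 0%N) p I).
    exact: (proj1 (sF2 1 0%N) p I).
  have := continuous_pairf c1 c2.
  by under [X in continuous X -> _]eq_fun do rewrite -surjective_pairing.
have H0 : H 0 = knot_path K0 by apply/funext => t; rewrite /H F0.
have H1 : H 1 = knot_path K by apply/funext => t; rewrite /H F1.
have H01 : H^~ 1 = H^~ 0.
  by apply/funext => u; rewrite /H -[1]add0r circ_expD1.
have := homotopy_class k 0 1 cH; rewrite H0 H1 H01 => e.
have e0 := arc_class_loop (knot_path K0).
by move: e; rewrite e0 subr0 => ->; rewrite subrr.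
Qed.

Lemma period_class K (t : R) (n : int) : is_knot K -> isotopic K0 K ->
  arc_class (knot_path K) t (t + n%:~R) = 0.
Proof.
move=> knotK isoK; have cK := knot_path_continuous knotK.
have shift s s' (m : int) : arc_class (knot_path K) (s + m%:~R) (s' + m%:~R) =
    arc_class (knot_path K) s s'.
  apply: path_class_ext => v _; rewrite addrAC opprD addrACA subrr addr0.
  exact: knot_pathD.
have per1 s : arc_class (knot_path K) s (s + 1) = 0.
  by rewrite arc_class_period ?isotopic_class // => u; exact: (knot_pathD K u 1).
have pern s (m : nat) : arc_class (knot_path K) s (s + m%:R) = 0.
  elim: m => [|m ih]; first by rewrite addr0 arc_classxx.
  by rewrite -natr1 addrA -(arc_classD k s (s + m%:R)) // ih per1 addr0.
case: n => m; first exact: pern.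
rewrite NegzE rmorphN /= arc_classN // -{2}(subrK m.+1%:R t).
by rewrite pern oppr0.
Qed.

(** A full turn of a parameter adds the class of the knot, which is trivial. *)
Lemma double_point_class_eq K x x' y y' : is_knot K -> isotopic K0 K ->
  circ_exp x = circ_exp x' -> circ_exp y = circ_exp y' ->
  double_point_class K x y = double_point_class K x' y'.
Proof.
move=> knotK isoK /circ_expP[n ->] /circ_expP[m ->].
have cK := knot_path_continuous knotK.
rewrite /double_point_class !knot_heightD !circ_expDint; congr (_ + _).
rewrite -(arc_classD k _ y') // -(arc_classD k y' x') // period_class // addr0.
by rewrite arc_classN // period_class // oppr0 add0r.
Qed.

Lemma crossing_loopP K x y : is_knot K ->
  (K (circ_exp x)).1 = (K (circ_exp y)).1 ->
  [/\ continuous (crossing_loop t0 K x y),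
      crossing_loop t0 K x y 0 = crossing_loop t0 K x y 1 &
      arc_class (crossing_loop t0 K x y) 0 1 = double_point_class K x y].
Proof.
move=> knotK xy; have cK := knot_path_continuous knotK.
set hx := knot_height t0 K x; set hy := knot_height t0 K y.
pose A u := fiber_path t0 (K (circ_exp x)).1 ((1 - 2 * u) * hx + 2 * u * hy).
pose B u := knot_path K (y + (2 * u - 1) * (x - y)).
have cE : crossing_loop t0 K x y = fun u => if u <= 2^-1 then A u else B u.
  by apply/funext => u; rewrite /crossing_loop /A /fiber_path addrA.
have cl (a b : R) : continuous (fun u : R => a + u * b).
  apply: continuous_addf; first exact: continuous_cstf.
  by apply: continuous_mulf; [exact: continuous_idf|exact: continuous_cstf].
have AE u : A u = fiber_path t0 (K (circ_exp x)).1 (hx + u * (2 * (hy - hx))).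
  by rewrite /A; congr fiber_path; ring.
have BE u : B u = knot_path K ((2 * y - x) + u * (2 * (x - y))).
  by rewrite /B; congr knot_path; ring.
have cA : continuous A.
  rewrite (funext AE).
  exact: (continuous_compf (cl _ _) (@fiber_path_continuous _ _ _ _)).
have cB : continuous B by rewrite (funext BE); exact: (continuous_compf (cl _ _) cK).
have AB : A 2^-1 = B 2^-1.
  rewrite /A /B /fiber_path divff ?pnatr_eq0 // subrr !mul0r mul1r add0r addr0.
  by rewrite knot_heightE xy -surjective_pairing.
have cc : continuous (crossing_loop t0 K x y).
  by rewrite cE; exact: continuous_paste_le.
split=> //.
  rewrite cE invr_ge0 ler0n (_ : 1 <= 2^-1 = false); last by apply/negbTE; rewrite -ltNge; lra.
  rewrite /A /B /fiber_path mulr0 subr0 !mul1r mul0r addr0 knot_heightE.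
  rewrite -surjective_pairing /knot_path mulr1 (_ : 2 - 1 = 1 :> R) ?mul1r; last by ring.
  by rewrite addrC subrK.
rewrite -(arc_classD k 0 2^-1 1) //; congr (_ + _).
  apply: arc_class_ext => u /andP[u0 u1]; rewrite cE ifT; last first.
    by rewrite subr0 add0r ler_piMl // invr_ge0.
  by rewrite AE /hx /hy; congr fiber_path; field.
apply: arc_class_ext => u /andP[u0 u1]; rewrite cE.
have vE : B (2^-1 + u * (1 - 2^-1)) = knot_path K (y + u * (x - y)).
  by rewrite /B; congr knot_path; field.
case: ifP => // v1.
have v0 : 2^-1 + u * (1 - 2^-1) = 2^-1 :> R by move: v1; lra.
by rewrite -vE v0.
Qed.

Lemma H1mod_chain_parity_class K x y : is_knot K ->
  (K (circ_exp x)).1 = (K (circ_exp y)).1 ->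
  H1mod_chain (parity_class t0 K0 K x y) = double_point_class K x y.
Proof.
move=> knotK xy; have [cc c01 <-] := crossing_loopP knotK xy.
by apply: H1mod_chain_loop => //; [exact: knot_path_continuous|exact: knot_path01].
Qed.

(** There are no triple points, and the heights tell the two preimages apart. *)
Lemma crossing_params_unique K c x y x' y' : general_position t0 K ->
  let D := diagram_of t0 K in
  over D (circ_exp x) (circ_exp y) -> curve D (circ_exp x) = c ->
  over D (circ_exp x') (circ_exp y') -> curve D (circ_exp x') = c ->
  circ_exp x = circ_exp x' /\ circ_exp y = circ_exp y'.
Proof.
move=> [_ _ _ tri _] D [/eqP xy cxy hxy] /= cx [/eqP xy' cxy' hxy'] /= cx'.
have e1 : (K (circ_exp y)).1 = c by rewrite -cxy.
have e2 : (K (circ_exp y')).1 = c by rewrite -cxy'.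
have tri' a b d : (K a).1 = c -> (K b).1 = c -> (K d).1 = c ->
    [\/ a = b, b = d | a = d].
  by move=> ea eb ed; apply: tri; rewrite ?ea ?eb ?ed.
have [//|yx'|xx'] := tri' (circ_exp x) (circ_exp y) (circ_exp x') cx e1 cx'.
  have [//|yy'|xy''] := tri' (circ_exp x) (circ_exp y) (circ_exp y') cx e1 e2.
    by case: xy'; rewrite -yy' yx'.
  move: hxy'; rewrite -yx' -xy'' => h1.
  by have := lt_trans h1 hxy; rewrite ltxx.
have [//|yy'|xy''] := tri' (circ_exp x) (circ_exp y) (circ_exp y') cx e1 e2.
  by [].
by case: xy'; rewrite -xx'.
Qed.

(** The projections agree, so the homotopy moves along the circle only. *)
Lemma double_point_class_diagram K K' x y : is_knot K -> is_knot K' ->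
  general_position t0 K -> general_position t0 K' ->
  diagram_of t0 K = diagram_of t0 K' -> (K (circ_exp x)).1 = (K (circ_exp y)).1 ->
  double_point_class K' x y = double_point_class K x y.
Proof.
move=> knotK knotK' genK genK' DD xy.
have cE : (fun s => (K s).1) = (fun s => (K' s).1) by case: DD.
have cS t : (K (circ_exp t)).1 = (K' (circ_exp t)).1 by exact: (congr1 (fun f => f _) cE).
rewrite (@double_point_class_homotopy R S t0 k K K' (fun _ t => (K (circ_exp t)).1)
  id (fun=> 0) _ _ _ _ _ _ _ _ x y) //.
- by rewrite /= !addr0 !arc_classxx ?subrr ?addr0 //; exact: fiber_path_continuous.
- exact: (continuous_compf (@continuous_sndf R R) (knot_surf_continuous knotK)).
- by move=> t; exact: cvg_id.
- have := @continuous_height_difference R S t0 K K' knotK knotK' genK genK' id.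
  rewrite DD; under [X in _ -> continuous X]eq_fun do rewrite addr0.
  apply=> // t; first exact: cvg_id.
    exact: nbhs_left_lt.
  exact: nbhs_right_gt.
- by move=> t; rewrite addr0 circ_exp_height.
Qed.

Lemma shift_above (x y : R) : circ_exp x <> circ_exp y ->
  exists2 x' : R, circ_exp x' = circ_exp x & y < x' < y + 1.
Proof.
move=> xy; pose n := - Num.floor (x - y); exists (x + n%:~R).
  exact: circ_expDint.
have /andP[d0 d1] := floor_itv (x - y); rewrite intrD in d1.
rewrite /n rmorphN /= lt_neqAle; apply/andP; split; last lra.
apply/andP; split; last lra.
apply/eqP => e; apply: xy; apply/circ_expP; exists (Num.floor (x - y)); lra.
Qed.

(** The representative chosen in the definition of the parity has the same
    diagram as [K], hence the same double points, and it is homotopic to [K]. *)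
Lemma H1mod_chain_parity K D (c : crossing D) x y : represents t0 K0 K D ->
  over D (circ_exp x) (circ_exp y) -> curve D (circ_exp x) = set_val c ->
  H1mod_chain (homological_winding_parity t0 K0 c) = double_point_class K x y.
Proof.
move=> rep o cx; rewrite /homological_winding_parity.
case: xgetP => [h _ [K' [x' [y' [rep' [_ o' cx'] ->]]]]|none]; last first.
  have [x' xx' yx'] : exists2 x', circ_exp x' = circ_exp x & y < x' < y + 1.
    by apply: shift_above; case: rep o => _ _ _ -> [/eqP].
  exfalso; apply: (none (parity_class t0 K0 K x' y)); exists K, x', y.
  by split=> //; split; rewrite ?xx'.
case: rep' o o' cx cx' => knotK' isoK' genK' D'E o o' cx cx'.
case: rep => knotK isoK genK DE.
have DD : diagram_of t0 K = diagram_of t0 K' by rewrite -DE.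
subst D.
have [xx yy] := crossing_params_unique genK' o cx o' cx'.
have e' : (K' (circ_exp x')).1 = (K' (circ_exp y')).1 by case: o'.
rewrite H1mod_chain_parity_class // -(double_point_class_eq knotK' isoK' xx yy).
apply: double_point_class_diagram => //.
by move: o; rewrite -DD => -[].
Qed.

Lemma H1mod_chain_hwp_inj D D' (c : crossing D) (c' : crossing D') :
  H1mod_chain (homological_winding_parity t0 K0 c) =
  H1mod_chain (homological_winding_parity t0 K0 c') ->
  homological_winding_parity t0 K0 c = homological_winding_parity t0 K0 c'.
Proof.
by apply: H1mod_chain_inj; [exact: knot_path_continuous|exact: knot_path01].
Qed.

Lemma parity_class_representative K D (c : crossing D) x y :
  represents t0 K0 K D -> crossing_parameters D (set_val c) x y ->
  homological_winding_parity t0 K0 c = parity_class t0 K0 K x y.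
Proof.
move=> rep [_ o cx].
apply: H1mod_chain_inj; [exact: knot_path_continuous|exact: knot_path01|].
have [knotK _ _ DE] := rep.
rewrite (H1mod_chain_parity rep o cx) H1mod_chain_parity_class //.
by move: o; rewrite DE => -[].
Qed.

Lemma crossing_preimages D (c : crossing D) : exists x y : R,
  over D (circ_exp x) (circ_exp y) /\ curve D (circ_exp x) = set_val c.
Proof.
have [s [t [st cs]]] := set_mem (valP c).
have [x xs] := circ_exp_surj s; have [y yt] := circ_exp_surj t.
by exists x, y; rewrite xs yt.
Qed.
End ParityClass.

(** * Topology of the surface *)

Section SurfaceTopology.
Context {R : realType} (S : surface R).

(** Near a point the family is read in a chart. *)
Lemma ambient_isotopy_continuous (Phi : R -> S -> S) : ambient_isotopy Phi ->
  continuous (fun p : R * S => Phi p.1 p.2).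
Proof.
move=> [sm _ _] [u p].
have [phi aphi pphi] := atlas_cover p.
have [oc _ cK cc _] := atlas_chart aphi.
have [cF _] := sm phi aphi.
have F := cF (u, cmap phi p) (conj I (ex_intro2 _ _ p pphi erefl)).
have c2 : (fun q : R * S => (q.1, cmap phi q.2)) @ (u, p) --> (u, cmap phi p).
  move=> A [[P Q] /= [uP pQ] PQA]; exists (P, cmap phi @^-1` Q) => /=.
    by split=> //; exact: (cc p pphi).
  by move=> [v q] [vP qQ]; apply: PQA.
have := cvg_comp _ _ c2 F; rewrite /= cK //.
rewrite /continuous_at => H; apply: cvg_trans H; apply: near_eq_cvg.
have pn : \forall q \near (u, p), cdom phi q.2.
  exists (setT, cdom phi) => /=; last by move=> q [].
  by split; [exact: filterT|exact: open_nbhs_nbhs].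
by near=> q; rewrite /= cK //; near: q.
Unshelve. all: end_near. Qed.

Variable k : chain (R := R) (S * circle R)%type 1.

Definition circle_path (p : S) (u : R) : S * circle R := (p, circ_exp u).

Lemma circle_path_continuous p : continuous (circle_path p).
Proof.
by apply: continuous_pairf; [exact: continuous_cstf|exact: circ_exp_continuous].
Qed.

Lemma fiber_path_class t0 p h :
  arc_class k (fiber_path t0 p) h (h + 1) = arc_class k (circle_path p) 0 1.
Proof.
transitivity (arc_class k (circle_path p) (t0 + h) (t0 + h + 1)).
  apply: arc_class_ext => u _; rewrite /fiber_path /circle_path.
  by congr (_, circ_exp _); ring.
apply: arc_class_period; first exact: circle_path_continuous.
by move=> u; rewrite /circle_path circ_expD1.
Qed.

(** Inside a ball of a chart, moving along a segment carries one fibre to the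
    other. *)
Lemma circle_path_class_near p :
  \forall q \near p, arc_class k (circle_path q) 0 1 = arc_class k (circle_path p) 0 1.
Proof.
have [phi aphi pphi] := atlas_cover p.
have [oc oi cK cc ci] := atlas_chart aphi.
have ip : cim phi (cmap phi p) by exists p.
have /nbhs_ballP[e e0 be] := open_nbhs_nbhs (conj oi ip).
have qn : \forall q \near p, cdom phi q /\ ball (cmap phi p) e (cmap phi q).
  have q1 : \forall q \near p, cdom phi q by exact: open_nbhs_nbhs.
  have q2 : \forall q \near p, ball (cmap phi p) e (cmap phi q).
    by apply: (cc p pphi); exact: nbhsx_ballx.
  by apply: filterS2 q1 q2.
apply: filterS qn => q [qd qb].
pose clamp (u : R) := Order.max 0 (Order.min u 1).
pose Y u : plane R := cmap phi p + clamp u *: (cmap phi q - cmap phi p).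
have clamp01 u : 0 <= clamp u <= 1.
  by rewrite /clamp le_max lexx ge_max ler01 ge_min lexx orbT.
have Yim u : cim phi (Y u).
  apply: be; rewrite -ball_normE /ball_ /= /Y opprD addrA subrr sub0r normrN normrZ.
  have /andP[u0 u1] := clamp01 u.
  rewrite ger0_norm //; apply: (le_lt_trans (y := 1 * `|cmap phi q - cmap phi p|)).
    by rewrite ler_wpM2r.
  by rewrite mul1r distrC; move: qb; rewrite -ball_normE.
have cY : continuous Y.
  apply: continuous_addf; first exact: continuous_cstf.
  apply: continuous_scalef; last exact: continuous_cstf.
  move=> u; apply: (@continuous_max R _ _ _ u); first exact: cvg_cst.
  by apply: (@continuous_min R _ _ _ u); [exact: cvg_id|exact: cvg_cst].
pose H (u t : R) : S * circle R := (cinv phi (Y u), circ_exp t).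
have cH : continuous (fun x : R * R => H x.1 x.2).
  apply: continuous_pairf.
    have cI : continuous (fun u => cinv phi (Y u)).
      by move=> u; apply: continuous_comp; [exact: cY|exact: ci].
    exact: (continuous_compf (@continuous_fstf R R) cI).
  exact: (continuous_compf (@continuous_sndf R R) (@circ_exp_continuous R)).
have H0 : H 0 = circle_path p.
  apply/funext => t; rewrite /H /Y (_ : clamp 0 = 0) ?scale0r ?addr0 ?cK //.
  by rewrite /clamp min_l ?maxxx.
have H1 : H 1 = circle_path q.
  apply/funext => t; rewrite /H /Y (_ : clamp 1 = 1) ?scale1r.
    by rewrite addrC subrK cK.
  by rewrite /clamp minxx max_r.
have H01 : H^~ 1 = H^~ 0.
  by apply/funext => u; rewrite /H -[1]add0r circ_expD1.
have := homotopy_class k 0 1 cH; rewrite H0 H1 H01 [RHS]subrr.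
exact: subr0_eq.
Unshelve. all: end_near. Qed.

(** The class of the fibre is locally constant on the connected surface. *)
Lemma circle_path_class_cst p q :
  arc_class k (circle_path p) 0 1 = arc_class k (circle_path q) 0 1.
Proof.
pose A := [set x : S | arc_class k (circle_path x) 0 1 = arc_class k (circle_path q) 0 1].
have oA : open A.
  rewrite openE => x Ax; apply: filterS (circle_path_class_near x) => y yx.
  by rewrite /A /= yx.
have cA : closed A.
  rewrite -openC openE => x nAx; apply: filterS (circle_path_class_near x) => y yx.
  by rewrite /A /= yx.
have AT : A = setT.
  apply: (surface_connected (s := S)).
  - by exists q.
  - by exists A => //; rewrite setTI.
  - by exists A => //; rewrite setTI.
have : A p by rewrite AT.
by [].
Qed.

End SurfaceTopology.

(** * Discs *)

Section Discs.
Context {R : realType}.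

(** Radial retraction onto the unit disc, which extends a map of the disc
    continuously to the plane. *)
Definition retract (w : plane R) : plane R :=
  (Order.max 1 (Num.sqrt (w 0 0 ^+ 2 + w 0 1 ^+ 2)))^-1 *: w.

Lemma retract_unit_disc w : unit_disc (retract w).
Proof.
rewrite /unit_disc /retract /= !mxE !exprMn -mulrDr.
set q := w 0 0 ^+ 2 + w 0 1 ^+ 2; have q0 : 0 <= q by rewrite addr_ge0 ?sqr_ge0.
set m := Order.max _ _; have m1 : 1 <= m by rewrite le_max lexx.
have m0 : 0 < m by exact: lt_le_trans m1.
rewrite exprVn mulrC ler_pdivrMr ?exprn_gt0 // mul1r -(sqr_sqrtr q0).
by rewrite ler_pXn2r ?nnegrE ?sqrtr_ge0 ?(ltW m0) // le_max lexx orbT.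
Qed.

Lemma retract_id w : unit_disc w -> retract w = w.
Proof.
rewrite /unit_disc /retract /= => w1.
rewrite max_l ?invr1 ?scale1r // -[leRHS]sqrtr1.
exact: ler_wsqrtr.
Qed.

Lemma continuous_sqnorm :
  continuous (fun w : plane R => w 0 0 ^+ 2 + w 0 1 ^+ 2).
Proof.
have cc i : continuous (fun w : plane R => w 0 i ^+ 2).
  under eq_fun do rewrite expr2.
  by apply: continuous_mulf => w; exact: coord_continuous.
exact: (@continuous_addf R R^o _ _ _ (cc 0) (cc 1)).
Qed.

Lemma retract_continuous : continuous retract.
Proof.
apply: continuous_scalef; last exact: continuous_idf.
pose m (w : plane R) := Order.max 1 (Num.sqrt (w 0 0 ^+ 2 + w 0 1 ^+ 2)).
have m0 w : m w != 0 by rewrite gt_eqF // lt_max ltr01.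
have cm : continuous m.
  move=> w; apply: (@continuous_max R _ (fun=> 1)
    (fun w : plane R => Num.sqrt (w 0 0 ^+ 2 + w 0 1 ^+ 2)) w).
    exact: continuous_cstf.
  apply: (continuous_comp (f := fun w : plane R => w 0 0 ^+ 2 + w 0 1 ^+ 2)).
    exact: continuous_sqnorm.
  exact: sqrt_continuous.
by move=> w; exact: (cvgV (m0 w) (cm w)).
Qed.

Lemma unit_disc_compact : compact (@unit_disc R).
Proof.
have box := @rV_compact R 2 (fun=> `[(- 1), 1]%classic) (fun=> @segment_compact R _ _).
apply: subclosed_compact box _.
  rewrite (_ : unit_disc =
    (fun w : plane R => w 0 0 ^+ 2 + w 0 1 ^+ 2) @^-1` [set x | x <= 1]).
    by apply: (preimage_closed _ (@closed_le _ _)) => w _; exact: continuous_sqnorm.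
  by [].
move=> w w1 i /=; rewrite in_itv /= -ler_norml -(@expr_le1 _ 2) ?normr_ge0 //.
rewrite real_normK ?num_real //; apply: le_trans w1.
by have [->|->] := ord2 i; rewrite ?lerDl ?lerDr sqr_ge0.
Qed.

Variables (T : topologicalType) (disc : plane R -> T).
Hypotheses (hT : hausdorff_space T) (cdisc : {within unit_disc, continuous disc}).
Hypothesis idisc : set_inj unit_disc disc.

Definition disc_image : set T := disc @` unit_disc.

Lemma disc_image_closed : closed disc_image.
Proof.
by apply: compact_closed => //; apply: continuous_compact unit_disc_compact.
Qed.

Definition disc_coord (p : T) : plane R :=
  xget 0 [set w | unit_disc w /\ disc w = p].

Lemma disc_coordP p : disc_image p -> unit_disc (disc_coord p) /\ disc (disc_coord p) = p.
Proof.
move=> [w w1 wp]; rewrite /disc_coord; case: xgetP => [v _ //|none].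
by case: (none w).
Qed.

(** A continuous injection of a compact space into a Hausdorff space is closed. *)
Lemma disc_coord_continuous p : disc_image p ->
  disc_coord @ within disc_image (nbhs p) --> disc_coord p.
Proof.
move=> Dp A /nbhs_interior; set U := A° => nU.
pose C := unit_disc `&` ~` U.
have cC : compact C.
  apply: (@subclosed_compact _ _ _ _ unit_disc_compact); last by move=> w [].
  apply: closedI; first exact: compact_closed (@norm_hausdorff _ _) unit_disc_compact.
  by rewrite closedC; exact: open_interior.
have clC : closed (disc @` C).
  apply: compact_closed hT _; apply: continuous_compact cC.
  by apply: continuous_subspaceW cdisc => w [].
have [Dw dw] := disc_coordP Dp.
have pC : (~` (disc @` C)) p.
  move=> [w [w1 wU] wp]; apply: wU; rewrite -(idisc (x := disc_coord p) (y := w)) ?inE ?dw //.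
  exact: nbhs_singleton nU.
have nC : nbhs p (~` (disc @` C)).
  by apply: open_nbhs_nbhs; split=> //; rewrite openC.
apply: filterS nC => q nq Dq /=.
have [q1 q2] := disc_coordP Dq.
apply: interior_subset; apply: contrapT => nUq; apply: nq.
by exists (disc_coord q).
Qed.

Definition disc_extension (w : plane R) : T := disc (retract w).

Lemma disc_extension_continuous : continuous disc_extension.
Proof.
move=> w A An.
have /subspace_continuousP cd := cdisc.
have H : within unit_disc (nbhs (retract w)) (disc @^-1` A).
  by apply: (cd _ (retract_unit_disc w)).
have H' : \forall v \near w, unit_disc (retract v) -> A (disc (retract v)).
  exact: (@retract_continuous w _ H).
by apply: filterS H' => v; apply; exact: retract_unit_disc.
Qed.

Lemma disc_extension_coord p : disc_image p -> disc_extension (disc_coord p) = p.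
Proof. by move=> /disc_coordP[p1 p2]; rewrite /disc_extension retract_id. Qed.

End Discs.

(** * Knots meeting a disc in arcs *)

Section DiscStrands.
Context {R : realType} (S : surface R).
Variables (t0 : R) (k : chain (R := R) (S * circle R)%type 1).
Variable disc : plane R -> S.
Hypotheses (cdisc : {within unit_disc, continuous disc}).
Hypothesis idisc : set_inj unit_disc disc.
Let hS : hausdorff_space S := surface_hausdorff (s := S).
Implicit Types (K : knot_map S).
Local Notation arc_class := (arc_class k).

Definition disc_height (q : plane R * R^o) : S * circle R :=
  (disc_extension disc q.1, circ_exp (t0 + q.2)).

Lemma disc_height_continuous : continuous disc_height.
Proof.
apply: continuous_pairf.
  exact: (continuous_compf (@continuous_fstf (plane R) R) (disc_extension_continuous cdisc)).
apply: (continuous_compf _ (@circ_exp_continuous R)).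
by apply: continuous_addf; [exact: continuous_cstf|exact: (@continuous_sndf (plane R) R)].
Qed.

(** A primitive: since plane x R is contractible, the class of an arc that lifts to
    it is the difference of the potentials of the endpoints of the lift. *)
Definition disc_potential (q : plane R * R^o) := segment_class k disc_height 0 q.

Lemma disc_potentialE p q :
  segment_class k disc_height p q = disc_potential q - disc_potential p.
Proof.
apply/eqP; rewrite eq_sym subr_eq addrC segment_classD //.
exact: disc_height_continuous.
Qed.

Definition disc_lift K (t : R) : plane R * R^o :=
  (disc_coord disc (K (circ_exp t)).1, knot_height t0 K t).

Lemma disc_heightK K t : disc_image disc (K (circ_exp t)).1 ->
  disc_height (disc_lift K t) = knot_path K t.
Proof.
move=> Dt; rewrite /disc_height /= disc_extension_coord // knot_heightE.
by rewrite -surjective_pairing.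
Qed.

(** The potential minus a primitive of the arcs of the knot. *)
Definition strand_const K (t : R) :=
  disc_potential (disc_lift K t) - arc_class (knot_path K) 0 t.

Lemma fiber_path_disc p (h h' : R) : disc_image disc p ->
  arc_class (fiber_path t0 p) h h' =
  disc_potential (disc_coord disc p, h') - disc_potential (disc_coord disc p, h).
Proof.
move=> Dp; rewrite -disc_potentialE; apply: path_class_ext => v _.
rewrite /fiber_path /disc_height /= subrr scaler0 addr0.
by rewrite disc_extension_coord.
Qed.

(** Without double lines on the strand, the height is a continuous lift, so the
    potential of the lift measures the arcs of the strand. *)
Lemma strand_const_cst K (s t : R) : is_knot K -> general_position t0 K ->
  s <= t -> (forall u, s <= u <= t -> disc_image disc (K (circ_exp u)).1) ->
  (forall u, s <= u <= t -> ~ marks (diagram_of t0 K) (circ_exp u)) ->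
  strand_const K t = strand_const K s.
Proof.
move=> knotK genK st Dst Mst; have cK := knot_continuous knotK.
(* Clamping the parameter extends the lift of the strand to the real line. *)
pose cl (u : R) := Order.max s (Order.min u t).
have clst u : s <= cl u <= t.
  by rewrite /cl le_max lexx ge_max st ge_min lexx orbT.
have clid u : s <= u <= t -> cl u = u.
  by move=> /andP[su ut]; rewrite /cl min_l // max_r.
have ccl : continuous cl.
  move=> u; apply: (@continuous_max R _ _ _ u); first exact: cvg_cst.
  by apply: (@continuous_min R _ _ _ u); [exact: cvg_id|exact: cvg_cst].
have cq : continuous (fun u => disc_lift K (cl u)).
  apply: continuous_pairf; last first.
    move=> u; apply: (@continuous_comp _ _ _ cl (knot_height t0 K)); first exact: ccl.
    by apply: unmarked_continuous => //; exact: Mst.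
  move=> u A nA.
  have H := disc_coord_continuous hS cdisc idisc (Dst _ (clst u)) nA.
  have cs : continuous (fun u => (K (circ_exp (cl u))).1).
    exact: (continuous_compf ccl (knot_surf_continuous knotK)).
  have H' : \forall v \near u, disc_image disc (K (circ_exp (cl v))).1 ->
      A (disc_coord disc (K (circ_exp (cl v))).1) by exact: (cs u _ H).
  by apply: filterS H' => v; apply; exact: Dst.
have e : arc_class (knot_path K) s t =
    disc_potential (disc_lift K t) - disc_potential (disc_lift K s).
  have := lifted_class k s t disc_height_continuous cq.
  rewrite !clid ?lexx ?st // disc_potentialE => <-.
  apply: arc_class_ext => u /andP[u0 u1] /=.
  rewrite clid ?disc_heightK //.
    by apply: Dst; apply/andP; split; nra.
  by apply/andP; split; nra.
rewrite /strand_const.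
have -> : disc_potential (disc_lift K t) =
    disc_potential (disc_lift K s) + arc_class (knot_path K) s t.
  by rewrite e addrC subrK.
rewrite -(arc_classD k 0 s t) //.
by rewrite [X in _ - X]addrC opprD addrA addrK.
Qed.

(** The vertical segment over a point of the disc is also measured by the
    potential. *)
Lemma double_point_class_disc K x y : is_knot K ->
  (K (circ_exp x)).1 = (K (circ_exp y)).1 -> disc_image disc (K (circ_exp x)).1 ->
  double_point_class t0 k K x y = strand_const K y - strand_const K x.
Proof.
move=> knotK xy Dx; have cK := knot_continuous knotK.
rewrite /double_point_class fiber_path_disc // /strand_const /disc_lift -xy.
have -> : arc_class (knot_path K) y x =
    arc_class (knot_path K) 0 x - arc_class (knot_path K) 0 y.
  by apply/eqP; rewrite eq_sym subr_eq addrC arc_classD.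
have regroup (V : zmodType) (p q u v : V) : p - q + (u - v) = p - v - (q - u).
  by rewrite opprB addrACA [RHS]addrACA [- q - v]addrC.
exact: regroup.
Qed.

(** Two paths that differ inside a disc only are joined by straight lines in the
    coordinates of the disc. *)
Lemma disc_homotopy (f g : R -> S) (B : set R) :
  continuous f -> continuous g -> closed B ->
  (forall t, disc_image disc (f t) <-> disc_image disc (g t)) ->
  (forall t, B t \/ disc_image disc (f t)) -> (forall t, B t -> g t = f t) ->
  exists Sig : R -> R -> S,
    [/\ continuous (fun p : R * R => Sig p.1 p.2), forall t, Sig 0 t = f t,
        forall t, Sig 1 t = g t & forall u t, B t -> Sig u t = f t].
Proof.
move=> cf cg cB fg BD gf.
pose wf t := disc_coord disc (f t); pose wg t := disc_coord disc (g t).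
pose L (u t : R) := disc_extension disc ((1 - u) *: wf t + u *: wg t).
pose Sig (u t : R) : S := if pselect (B t) then f t else L u t.
have LB u t : B t -> disc_image disc (f t) -> L u t = f t.
  move=> Bt Dt; rewrite /L /wg gf // -/(wf t) -scalerDl subrK scale1r.
  exact: disc_extension_coord.
pose A := [set t | disc_image disc (f t)].
have cA : closed A.
  by apply: (preimage_closed _ (disc_image_closed hS cdisc)) => t _; exact: cf.
have coordA h t : continuous h -> (forall v, A v -> disc_image disc (h v)) -> A t ->
    (fun v => disc_coord disc (h v)) @ within A (nbhs t) --> disc_coord disc (h t).
  move=> ch hA At W nW.
  have H := disc_coord_continuous hS cdisc idisc (hA _ At) nW.
  have H' : \forall v \near t, disc_image disc (h v) -> W (disc_coord disc (h v)).
    exact: (ch t _ H).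
  by apply: filterS H' => v vW Av; apply: vW; exact: hA.
have cL u t W : A t -> nbhs (L u t) W ->
    \forall p \near (u, t), A p.2 -> W (L p.1 p.2).
  move=> At nW; pose F := within [set p : R * R | A p.2] (nbhs (u, t)).
  have Fs : (fun p : R * R => p.2) @ F --> within A (nbhs t).
    move=> Y tY; exists (setT, [set v | A v -> Y v]) => /=.
      by split; [exact: filterT|exact: tY].
    by move=> [v s] [_ sY] /= As; exact: sY.
  have F1 : (fun p : R * R => p.1) @ F --> u.
    move=> Y uY; exists (Y, setT) => /=; first by split; [exact: uY|exact: filterT].
    by move=> [v s] [vY _] _.
  have FF : Filter F by exact: within_filter.
  have Ff : (fun p : R * R => wf p.2) @ F --> wf t.
    by apply: (cvg_comp _ _ Fs); apply: coordA.
  have Fg : (fun p : R * R => wg p.2) @ F --> wg t.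
    by apply: (cvg_comp _ _ Fs); apply: coordA => // v /fg.
  have FL : (fun p : R * R => (1 - p.1) *: wf p.2 + p.1 *: wg p.2) @ F -->
      (1 - u) *: wf t + u *: wg t.
    apply: cvgD; apply: cvgZ => //.
    by apply: cvgB; [exact: cvg_cst|exact: F1].
  have ce := @disc_extension_continuous _ _ disc cdisc ((1 - u) *: wf t + u *: wg t).
  exact: (FL _ (ce W nW)).
exists Sig; split.
- move=> [u t] W nW; rewrite /= in nW.
  have n1 : \forall p \near (u, t), B p.2 -> W (f p.2).
    have [Bt|nBt] := pselect (B t).
      exists (setT, f @^-1` W) => /=; last by move=> p [].
      by split; [exact: filterT|apply: cf; move: nW; rewrite /Sig; case: pselect].
    exists (setT, ~` B) => /=; last by move=> p [_ nB] /nB.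
    by split; [exact: filterT|apply: open_nbhs_nbhs; split; rewrite ?openC].
  have n2 : \forall p \near (u, t), ~ B p.2 -> W (L p.1 p.2).
    have [At|nAt] := pselect (A t).
      have LS : Sig u t = L u t by rewrite /Sig; case: pselect => // Bt; rewrite LB.
      rewrite LS in nW; apply: filterS (cL u t W At nW) => p pW nB; apply: pW.
      by have [] := BD p.2.
    exists (setT, ~` A) => /=; last by move=> p [_ nA] nB; case: (BD p.2).
    by split; [exact: filterT|apply: open_nbhs_nbhs; split; rewrite ?openC].
  apply: filterS2 n1 n2 => p p1 p2; rewrite /= /Sig.
  by case: pselect => Bp; [exact: p1|exact: p2].
- move=> t; rewrite /Sig; case: pselect => // nBt.
  rewrite /L subr0 scale1r scale0r addr0 disc_extension_coord //.
  by have [] := BD t.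
- move=> t; rewrite /Sig; case: pselect => [Bt|nBt]; first by rewrite gf.
  rewrite /L subrr scale1r scale0r add0r disc_extension_coord //.
  by apply/fg; have [] := BD t.
- by move=> u t Bt; rewrite /Sig; case: pselect.
Qed.

End DiscStrands.

(** * Invariance under the moves *)

Section Moves.
Context {R : realType} (S : surface R).
Variables (t0 : R) (K0 : knot_map S).
Hypothesis knotK0 : is_knot K0.
Local Notation k := (path_chain (knot_path K0)).
Local Notation arc_class := (arc_class k).
Local Notation double_point_class := (double_point_class t0 k).
Local Notation hwp c := (homological_winding_parity t0 K0 c).
Local Notation dgm := (diagram_of_knot t0 K0).
Implicit Types (K : knot_map S) (D : diagram S).

Lemma over_curve K D s t : represents t0 K0 K D -> over D s t -> curve D s = curve D t.
Proof. by move=> [_ _ _ ->] []. Qed.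

Lemma hwp_eq K K' D D' (c : crossing D) (c' : crossing D') x y x' y' :
  represents t0 K0 K D -> represents t0 K0 K' D' ->
  over D (circ_exp x) (circ_exp y) -> curve D (circ_exp x) = set_val c ->
  over D' (circ_exp x') (circ_exp y') -> curve D' (circ_exp x') = set_val c' ->
  double_point_class K' x' y' = double_point_class K x y -> hwp c' = hwp c.
Proof.
move=> rep rep' o cx o' cx' e; apply: H1mod_chain_hwp_inj => //.
by rewrite (H1mod_chain_parity knotK0 rep o cx) (H1mod_chain_parity knotK0 rep' o' cx').
Qed.

(** The ambient isotopy moves the projections, and both preimages of a crossing
    follow it together. *)
Lemma hwp_isotopy D D' (Phi : R -> S -> S) (v : crossing D) (w : crossing D') :
  dgm D -> dgm D' -> diagram_isotopy D D' Phi ->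
  set_val w = Phi 1 (set_val v) -> hwp w = hwp v.
Proof.
move=> [K rep] [K' rep'] [amb [r [[sr r' r1] rD]]] wv.
have [x [y [st cx]]] := crossing_preimages v.
have oxy : curve D (circ_exp x) = curve D (circ_exp y) by exact: over_curve rep st.
have [c'x ovE _ _] := rD x.
apply: (hwp_eq rep rep' st cx ((ovE y).2 st)); first by rewrite c'x cx wv.
have [knotK _ genK DE] := rep; have [knotK' _ genK' D'E] := rep'.
have cr : continuous r by move=> t; exact: (proj1 (sr 0%N) t I).
have drt t : derivable r t 1.
  by have [_ /(_ 1)[d _]] := sr 1%N; exact: d.
have rlr t := derive1_gt0_near (drt t) (r' t).
have cE t : curve D' (circ_exp (r t)) = Phi 1 (curve D (circ_exp t)) by have [] := rD t.
have cD t : curve D t = (K t).1 by rewrite DE.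
have cD' t : curve D' t = (K' t).1 by rewrite D'E.
have [_ Phi0 _] := amb.
rewrite (@double_point_class_homotopy R S t0 k K K' (fun u t => Phi u (K (circ_exp t)).1)
  r (fun=> 0) _ _ _ _ _ _ _ _ x y) //.
- by rewrite !addr0 !arc_classxx ?subrr ?addr0 //; exact: fiber_path_continuous.
- have cP := ambient_isotopy_continuous amb.
  have c2 : continuous (fun p : R * R => (p.1, (K (circ_exp p.2)).1)).
    apply: continuous_pairf; first exact: continuous_fstf.
    exact: (continuous_compf (@continuous_sndf R R) (knot_surf_continuous knotK)).
  exact: (continuous_compf c2 cP).
- by move=> t; rewrite Phi0.
- by move=> t; rewrite -cD' cE cD.
- under eq_fun do rewrite addr0.
  apply: continuous_height_difference => // t.
  + by have [] := rlr t.
  + by have [] := rlr t.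
  + by have [_ _ uE _] := rD t; rewrite -DE -D'E.
  + by have [_ _ _ dE] := rD t; rewrite -DE -D'E.
- by move=> t; rewrite addr0 circ_exp_height.
- by move=> u; rewrite -!cD oxy.
Qed.

Lemma fiber_loop_class p q h (b : bool) :
  arc_class (fiber_path t0 p) h (h + b%:R) =
  if b then arc_class (circle_path q) 0 1 else 0.
Proof.
case: b; last by rewrite addr0 arc_classxx //; exact: fiber_path_continuous.
by rewrite fiber_path_class; exact: circle_path_class_cst.
Qed.

Variable z : S.
Local Notation fiber := (arc_class (circle_path z) 0 1).

(** Pushing an arc adds a full turn exactly at the points of the arc. *)
Lemma double_point_class_push K K' x y s t :
  is_knot K -> is_knot K' -> general_position t0 K -> general_position t0 K' ->
  let D := diagram_of t0 K in let D' := diagram_of t0 K' in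
  x < y -> y < x + 1 -> ~ marks D (circ_exp x) -> ~ marks D (circ_exp y) ->
  curve D' = curve D ->
  up D' = up D `|` [set circ_exp x] -> down D' = down D `|` [set circ_exp y] ->
  (K (circ_exp s)).1 = (K (circ_exp t)).1 ->
  let V s := if `[< arc x y (circ_exp s) >] then fiber else 0 in
  double_point_class K' s t = double_point_class K s t + (V s - V t).
Proof.
move=> knotK knotK' genK genK' D D' xy yx mx my cE upE downE st V.
have cS u : (K (circ_exp u)).1 = (K' (circ_exp u)).1.
  exact: (congr1 (fun f => f (circ_exp u)) (esym cE)).
rewrite (@double_point_class_homotopy R S t0 k K K' (fun _ t => (K (circ_exp t)).1)
  id (arc_indicator x y) _ _ _ _ _ _ _ _ s t) //.
- by rewrite /arc_indicator !(fiber_loop_class _ z).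
- exact: (continuous_compf (@continuous_sndf R R) (knot_surf_continuous knotK)).
- by move=> u; exact: cvg_id.
- exact: continuous_height_push.
- move=> u; rewrite addrA /arc_indicator; case: asbool.
    by rewrite circ_expD1 circ_exp_height.
  by rewrite addr0 circ_exp_height.
Qed.

End Moves.

(** * Moves through the base level *)

Lemma arc_compl (R : realType) (x y : R) (s : circle R) : y < x + 1 ->
  ~ arc x y s -> arc y (x + 1) s.
Proof.
move=> yx; have [t <-] := circ_exp_surj s => nxy.
have /andP[d0 d1] := floor_itv (t - x); rewrite intrD in d1.
set n := Num.floor _ in d0 d1.
have tn : circ_exp (t - n%:~R) = circ_exp t by rewrite -[in RHS](subrK n%:~R t) circ_expDint.
exists (t - n%:~R) => //=; rewrite in_itv /=.
have [ty|ty] := leP (t - n%:~R) y.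
  case: nxy; exists (t - n%:~R) => //=; rewrite in_itv /= ty andbT; lra.
by rewrite (ltW ty) /=; lra.
Qed.

Lemma arc_compl_interior (R : realType) (x t y : R) : x < t -> t < y ->
  ~ arc y (x + 1) (circ_exp t).
Proof.
move=> xt ty [u /=]; rewrite in_itv /= => /andP[yu ux] /circ_expP[n un].
have n0 : 0 < n by rewrite -(ltr_int R); lra.
have n1 : n < 1 by rewrite -(ltr_int R); lra.
by lia.
Qed.

Section PushMoves.
Context {R : realType} (S : surface R).
Variables (t0 : R) (K0 : knot_map S).
Hypothesis knotK0 : is_knot K0.
Local Notation k := (path_chain (knot_path K0)).
Local Notation arc_class := (arc_class k).
Local Notation double_point_class := (double_point_class t0 k).
Local Notation hwp c := (homological_winding_parity t0 K0 c).
Local Notation dgm := (diagram_of_knot t0 K0).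
Implicit Types (K : knot_map S) (D : diagram S).
Variable z : S.
Local Notation fiber := (arc_class (circle_path z) 0 1).
Local Notation vertical x y s := (if `[< arc x y (circ_exp s) >] then fiber else 0).

(** [D'] is obtained by pushing the arc between the parameters [x] and [y]
    upward through the base point of the circle.  Pushing it downward is, up to
    a full turn of the knot, pushing the complementary arc upward. *)
Definition pushed_up D D' (x y : R) :=
  [/\ x < y, y < x + 1, ~ marks D (circ_exp x) /\ ~ marks D (circ_exp y),
      curve D' = curve D &
      up D' = up D `|` [set circ_exp x] /\ down D' = down D `|` [set circ_exp y]].

Lemma pushed_class K K' D D' x y s t :
  represents t0 K0 K D -> represents t0 K0 K' D' -> pushed_up D D' x y ->
  curve D (circ_exp s) = curve D (circ_exp t) ->
  double_point_class K' s t =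
  double_point_class K s t + (vertical x y s - vertical x y t).
Proof.
move=> [knotK _ genK ->] [knotK' _ genK' ->] [xy yx [mx my] cE [uE dE]] st.
exact: double_point_class_push.
Qed.

Lemma push_down D D' x y : x < y -> y < x + 1 ->
  ~ marks D (circ_exp x) -> ~ marks D (circ_exp y) -> curve D' = curve D ->
  down D' = down D `|` [set circ_exp x] /\ up D' = up D `|` [set circ_exp y] ->
  pushed_up D D' y (x + 1).
Proof.
move=> xy yx mx my cE [dE uE].
by split; rewrite ?circ_expD1 ?ltrD2r //.
Qed.

Lemma hwp_pushed D D' x y s t (c : crossing D) (w : crossing D') :
  dgm D -> dgm D' -> pushed_up D D' x y -> set_val w = set_val c ->
  over D (circ_exp s) (circ_exp t) -> over D' (circ_exp s) (circ_exp t) ->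
  curve D (circ_exp s) = set_val c ->
  vertical x y s = vertical x y t -> hwp w = hwp c.
Proof.
move=> [K rep] [K' rep'] pu wc st st' cs vst.
have [_ _ _ cE _] := pu.
apply: (hwp_eq knotK0 rep rep' st cs st'); first by rewrite cE cs.
by rewrite (pushed_class rep rep' pu) ?(over_curve rep st) // vst subrr addr0.
Qed.

Lemma arc_ends (x y : R) : x < y -> arc x y (circ_exp x) /\ arc x y (circ_exp y).
Proof.
by move=> xy; split; [exists x|exists y] => //=; rewrite in_itv /= ?lexx ltW.
Qed.

Lemma off_arc_unmarked (x y : R) D : arc x y `&` marks D = set0 ->
  forall s, arc x y s -> ~ marks D s.
Proof. by move=> nm s xys ms; have : (arc x y `&` marks D) s by []; rewrite nm. Qed.

Lemma hwp_move5 D D' (c : crossing D) (w : crossing D') :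
  dgm D -> dgm D' -> move5 D D' -> set_val w = set_val c -> hwp w = hwp c.
Proof.
move=> dD dD' [x [y [/andP[xy yx] [nm nc] [cE oE] upd]]] wc.
have [K rep] := dD.
have [s [t [st cs]]] := crossing_preimages c.
have ct := esym (over_curve rep st).
have ns : ~ arc x y (circ_exp s).
  by move=> /nc; apply; rewrite cs; exact: (set_mem (valP c)).
have nt : ~ arc x y (circ_exp t).
  by move=> /nc; apply; rewrite ct cs; exact: (set_mem (valP c)).
have [ax ay] := arc_ends xy.
have [mx my] := (off_arc_unmarked nm ax, off_arc_unmarked nm ay).
have st' : over D' (circ_exp s) (circ_exp t) by rewrite oE.
case: upd => [[uE dE]|[dE uE]].
  have pu : pushed_up D D' x y by split.
  by apply: (hwp_pushed dD dD' pu wc st st' cs); rewrite !asboolF.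
have pu : pushed_up D D' y (x + 1) by exact: push_down.
apply: (hwp_pushed dD dD' pu wc st st' cs).
by rewrite !asboolT //; exact: arc_compl.
Qed.

Lemma hwp_move4 D D' v (c : crossing D) (w : crossing D') :
  dgm D -> dgm D' -> move4 D D' v -> set_val c <> v -> set_val w = set_val c ->
  hwp w = hwp c.
Proof.
move=> dD dD' [x [u [y [[xu uy yx] [cu vc] [nm nc] [cE oE] upd]]]] cv wc.
have [K rep] := dD; have xy := lt_trans xu uy.
have [s [t [st cs]]] := crossing_preimages c.
have ct := esym (over_curve rep st).
have ns : ~ arc x y (circ_exp s).
  move=> /nc; rewrite cs => /(_ (set_mem (valP c))) e.
  by apply: cv; rewrite -cs e.
have nt : ~ arc x y (circ_exp t).
  move=> /nc; rewrite ct cs => /(_ (set_mem (valP c))) e.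
  by apply: cv; rewrite -cs -ct e.
have [ax ay] := arc_ends xy.
have [mx my] := (off_arc_unmarked nm ax, off_arc_unmarked nm ay).
have st' : over D' (circ_exp s) (circ_exp t) by apply/oE; right; rewrite cs.
case: upd => [[_ [uE dE]]|[_ [dE uE]]].
  have pu : pushed_up D D' x y by split.
  by apply: (hwp_pushed dD dD' pu wc st st' cs); rewrite !asboolF.
have pu : pushed_up D D' y (x + 1) by exact: push_down.
apply: (hwp_pushed dD dD' pu wc st st' cs).
by rewrite !asboolT //; exact: arc_compl.
Qed.

Local Notation iota := (H1mod_chain (l := knot_path K0)).

(** The loops of the old and the new crossing run through their vertical segments
    and arcs in opposite directions, so only the turn added to one of the two
    strands remains. *)
Lemma parity_move4 D D' (c : crossing D) (w : crossing D') :
  dgm D -> dgm D' -> move4 D D' (set_val c) -> set_val w = set_val c ->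
  iota (hwp c) + iota (hwp w) = - fiber.
Proof.
move=> [K rep] [K' rep'] [x [u [y [[xu uy yx] [cu vc] [nm nc] [cE oE] upd]]]] wc.
have xy := lt_trans xu uy; have [ax ay] := arc_ends xy.
have [mx my] := (off_arc_unmarked nm ax, off_arc_unmarked nm ay).
have au : arc x y (circ_exp u) by exists u => //=; rewrite in_itv /= !ltW.
have [knotK' _ _ D'E] := rep'.
have off s : (over D (circ_exp u) (circ_exp s) \/ over D (circ_exp s) (circ_exp u)) ->
    curve D (circ_exp s) = set_val c /\ ~ arc x y (circ_exp s).
  move=> us.
  have cs : curve D (circ_exp s) = set_val c.
    by rewrite -cu; case: us => /(over_curve rep).
  split=> // /nc; rewrite cs => /(_ vc) e.
  by have [_ _ _ DE] := rep; case: us; rewrite DE e => -[/eqP].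
have eqK' s t : curve D' (circ_exp s) = curve D' (circ_exp t) ->
    (K' (circ_exp s)).1 = (K' (circ_exp t)).1 by rewrite D'E.
have sum (V : zmodType) (g a : V) : g - (g + a) = - a.
  by rewrite opprD addrA subrr sub0r.
case: upd => [[[q oq] [uE dE]]|[[q oq] [dE uE]]].
  have [s sq] := circ_exp_surj q; rewrite -sq in oq.
  have [cs ns] := off s (or_introl oq).
  have pu : pushed_up D D' x y by split.
  have oq' : over D' (circ_exp s) (circ_exp u) by apply/oE; left.
  rewrite (H1mod_chain_parity knotK0 rep oq cu).
  rewrite (H1mod_chain_parity knotK0 rep' oq'); last by rewrite cE cs wc.
  have su : (K' (circ_exp u)).1 = (K' (circ_exp s)).1.
    by apply: eqK'; rewrite cE cu cs.
  rewrite (double_point_classN _ _ knotK' su).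
  rewrite (pushed_class rep rep' pu) ?cu ?cs // (asboolT au) (asboolF ns) subr0.
  exact: sum.
have [s sq] := circ_exp_surj q; rewrite -sq in oq.
have [cs ns] := off s (or_intror oq).
have pu : pushed_up D D' y (x + 1) by exact: push_down.
have oq' : over D' (circ_exp u) (circ_exp s) by apply/oE; left.
rewrite (H1mod_chain_parity knotK0 rep oq cs).
rewrite (H1mod_chain_parity knotK0 rep' oq'); last by rewrite cE cu wc.
have su : (K' (circ_exp s)).1 = (K' (circ_exp u)).1.
  by apply: eqK'; rewrite cE cu cs.
rewrite (double_point_classN _ _ knotK' su).
have nu : ~ arc y (x + 1) (circ_exp u) by exact: arc_compl_interior.
have as' : arc y (x + 1) (circ_exp s) by exact: arc_compl.
rewrite (pushed_class rep rep' pu) ?cu ?cs // (asboolT as') (asboolF nu) subr0.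
exact: sum.
Qed.

End PushMoves.

(** * Moves in a disc *)

Lemma oarc_arc (R : realType) (a b : R) : oarc a b `<=` arc a b.
Proof.
move=> s [u /=]; rewrite !in_itv /= => /andP[au ub] us.
by exists u => //=; rewrite in_itv /= !ltW.
Qed.

Lemma oarc_open (R : realType) (a b : R) : open [set t : R | oarc a b (circ_exp t)].
Proof.
rewrite openE => t [u /=]; rewrite in_itv /= => /andP[au ub] /circ_expP[n un].
have at' : a - n%:~R < t by lra.
have tb : t < b - n%:~R by lra.
near=> s; exists (s + n%:~R); last exact: circ_expDint.
have as' : a - n%:~R < s by near: s; exact: lt_nbhsr.
have sb : s < b - n%:~R by near: s; exact: lt_nbhsl.
by rewrite /= in_itv /=; lra.
Unshelve. all: end_near. Qed.

Section InsideDisc.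
Context {R : realType} (S : surface R).
Variables (t0 : R) (K0 : knot_map S).
Hypothesis knotK0 : is_knot K0.
Local Notation k := (path_chain (knot_path K0)).
Local Notation arc_class := (arc_class k).
Local Notation double_point_class := (double_point_class t0 k).
Local Notation hwp c := (homological_winding_parity t0 K0 c).
Local Notation dgm := (diagram_of_knot t0 K0).
Local Notation iota := (H1mod_chain (l := knot_path K0)).
Implicit Types (K : knot_map S) (D : diagram S).
Variables (n : nat) (disc : plane R -> S) (a b : 'I_n -> R).
Hypotheses (cdisc : {within unit_disc, continuous disc}).
Hypothesis idisc : set_inj unit_disc disc.
Local Notation strand_const := (strand_const t0 k disc).

Lemma strand_in_disc D i t : disc_strands disc a b D -> a i <= t <= b i ->
  disc_image disc (curve D (circ_exp t)) /\ ~ marks D (circ_exp t).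
Proof.
move=> [_ _ pre _ nm] tab.
have ti : arc (a i) (b i) (circ_exp t) by exists t => //=; rewrite in_itv.
split; last exact: off_arc_unmarked (nm i) _ ti.
have : (curve D @^-1` (disc @` unit_disc)) (circ_exp t) by rewrite pre; exists i.
by [].
Qed.

Lemma strand_constE K D i t : represents t0 K0 K D -> disc_strands disc a b D ->
  a i <= t <= b i -> strand_const K t = strand_const K (a i).
Proof.
move=> [knotK _ genK DE] str /andP[at' tb].
apply: strand_const_cst => // u /andP[au ut].
  have [] := strand_in_disc (i := i) (t := u) str _; first by rewrite au (le_trans ut).
  by rewrite DE.
rewrite -DE; have [] // := strand_in_disc (i := i) (t := u) str _.
by rewrite au (le_trans ut).
Qed.

Lemma parity_strands K D (c : crossing D) i j : represents t0 K0 K D ->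
  disc_strands disc a b D -> strand_over a b D i j (set_val c) ->
  iota (hwp c) = strand_const K (a j) - strand_const K (a i).
Proof.
move=> rep str [_ [_ [[x xi <-] [y yj <-] xy cx]]].
rewrite /= in_itv /= in xi; rewrite /= in_itv /= in yj.
have xi' : a i <= x <= b i by case/andP: xi => ? ?; rewrite !ltW.
have yj' : a j <= y <= b j by case/andP: yj => ? ?; rewrite !ltW.
have [knotK _ genK DE] := rep.
rewrite (H1mod_chain_parity knotK0 rep xy cx) (double_point_class_disc _ _ cdisc) //.
- by rewrite (strand_constE rep str xi') (strand_constE rep str yj').
- by move: xy; rewrite DE => -[].
- by have [] := strand_in_disc str xi'; rewrite DE.
Qed.

Lemma arc_ends_outside D i : disc_strands disc a b D ->
  forall j, ~ oarc (a j) (b j) (circ_exp (a i)).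
Proof.
move=> [ab tri _ _ _] j aij.
have /andP[aib bia] := ab i.
have [ji|/eqP ji] := eqVneq j i.
  move: aij; rewrite ji => -[u /=]; rewrite in_itv /= => /andP[au ub] /circ_expP[m um].
  have m0 : 0 < m by rewrite -(ltr_int R); lra.
  have m1 : m < 1 by rewrite -(ltr_int R); lra.
  by lia.
apply: ji; apply: tri => //; exists (circ_exp (a i)); split; first exact: oarc_arc.
by exists (a i) => //=; rewrite in_itv /= lexx ltW.
Qed.

Section LocalChange.
Variables (K K' : knot_map S) (D D' : diagram S).
Hypotheses (rep : represents t0 K0 K D) (rep' : represents t0 K0 K' D').
Hypothesis loc : local_change disc a b D D'.

(** The closed set of the parameters outside the open arcs and the preimage of the
    disc cover the line, and the two curves agree on the former. *)
Lemma local_change_homotopy : exists Sig : R -> R -> S,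
  [/\ continuous (fun p : R * R => Sig p.1 p.2),
      forall t, Sig 0 t = (K (circ_exp t)).1,
      forall t, Sig 1 t = (K' (circ_exp t)).1 &
      forall u t, (forall j, ~ oarc (a j) (b j) (circ_exp t)) -> Sig u t = Sig 0 t].
Proof.
have [_ str str' _ out] := loc.
have [knotK _ _ DE] := rep; have [knotK' _ _ D'E] := rep'.
have cD t : curve D t = (K t).1 by rewrite DE.
have cD' t : curve D' t = (K' t).1 by rewrite D'E.
pose B : set R := [set t | forall j, ~ oarc (a j) (b j) (circ_exp t)].
have cB : closed B.
  rewrite (_ : B = ~` \bigcup_j [set t | oarc (a j) (b j) (circ_exp t)]).
    by apply: open_closedC; apply: bigcup_open => j _; exact: oarc_open.
  apply/seteqP; split=> t; first by move=> Bt [j _ /= tj]; exact: (Bt j).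
  by move=> Bt j tj; apply: Bt; exists j.
have dE t : disc_image disc (K (circ_exp t)).1 <-> disc_image disc (K' (circ_exp t)).1.
  have [_ _ pre _ _] := str; have [_ _ pre' _ _] := str'.
  rewrite -cD -cD'.
  rewrite (_ : disc_image disc (curve D _) =
    (curve D @^-1` (disc @` unit_disc)) (circ_exp t)) //.
  by rewrite pre -pre'.
have Bd t : B t \/ disc_image disc (K (circ_exp t)).1.
  have [Bt|nB] := pselect (B t); first by left.
  right; have [j /contrapT tj] : exists j, ~ ~ oarc (a j) (b j) (circ_exp t).
    exact/existsNP.
  have [_ _ pre _ _] := str; rewrite -cD.
  have : (curve D @^-1` (disc @` unit_disc)) (circ_exp t).
    by rewrite pre; exists j => //; exact: oarc_arc.
  by [].
have KB t : B t -> (K' (circ_exp t)).1 = (K (circ_exp t)).1.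
  by move=> Bt; rewrite -cD -cD'; have [] := out _ Bt.
have [Sig [cS S0 S1 SB]] := disc_homotopy cdisc idisc
  (knot_surf_continuous knotK) (knot_surf_continuous knotK') cB dE Bd KB.
by exists Sig; split=> // u t Bt; rewrite SB // S0.
Qed.

Lemma local_change_height : continuous (fun t => knot_height t0 K' t + 0 - knot_height t0 K t).
Proof.
have [_ _ _ [uE dE] _] := loc.
have [knotK _ genK DE] := rep; have [knotK' _ genK' D'E] := rep'.
under eq_fun do rewrite addr0.
apply: (@continuous_height_difference R S t0 K K' knotK knotK' genK genK' id).
- by move=> t; exact: cvg_id.
- by move=> t; exact: nbhs_left_lt.
- by move=> t; exact: nbhs_right_gt.
- by move=> t; rewrite -DE -D'E uE.
- by move=> t; rewrite -DE -D'E dE.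
Qed.

Let lift_height t : circ_exp (t0 + (knot_height t0 K' t + 0)) = (K' (circ_exp t)).2.
Proof. by rewrite addr0 circ_exp_height. Qed.

Lemma local_change_double_point x y :
  (forall j, ~ oarc (a j) (b j) (circ_exp x)) ->
  (forall j, ~ oarc (a j) (b j) (circ_exp y)) ->
  (K (circ_exp x)).1 = (K (circ_exp y)).1 ->
  double_point_class K' x y = double_point_class K x y.
Proof.
move=> xo yo xy; have [knotK _ _ _] := rep; have [knotK' _ _ _] := rep'.
have [Sig [cS S0 S1 SB]] := local_change_homotopy.
rewrite (@double_point_class_homotopy R S t0 k K K' Sig id (fun=> 0) _ _ _ _ _ _ _ _ x y) //.
- by rewrite !addr0 !arc_classxx ?subrr ?addr0 //; exact: fiber_path_continuous.
- by move=> t; exact: cvg_id.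
- exact: local_change_height.
- by move=> u; rewrite !SB // !S0.
Qed.

(** The constants of two strands change by the same amount: outside the disc the
    homotopy is vertical, and at the ends of the strands the vertical segments
    are those that compare the potentials. *)
Lemma local_change_strand_const i j :
  strand_const K' (a j) - strand_const K' (a i) =
  strand_const K (a j) - strand_const K (a i).
Proof.
have [knotK _ _ DE] := rep; have [knotK' _ _ D'E] := rep'.
have [_ str _ _ out] := loc.
have [Sig [cS S0 S1 SB]] := local_change_homotopy.
have ab m : a m <= a m <= b m.
  by have [/(_ m)/andP[/ltW ? _] _ _ _ _] := str; rewrite lexx.
have bo m := arc_ends_outside (i := m) str.
have := @knot_arc_homotopy R S t0 k K K' Sig id (fun=> 0) knotK knotK' cS _ S0 S1
  local_change_height lift_height (a j) (a i).
rewrite !stationary_track //; try by move=> u; rewrite SB.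
have Da m : disc_image disc (K (circ_exp (a m))).1.
  by have [] := strand_in_disc str (ab m); rewrite DE.
have KK' m : (K' (circ_exp (a m))).1 = (K (circ_exp (a m))).1.
  by have [] := out _ (bo m); rewrite DE D'E.
rewrite !(fiber_path_disc _ _ cdisc) // !addr0 /= => e.
rewrite /strand_const /disc_lift !KK'.
have regroup (V : zmodType) (p' q' p q A' A E : V) :
    p' - (A' + (E + (p' - p - (q' - q)))) - (q' - A') = p - (A + E) - (q - A).
  rewrite !opprD !opprK !addrA [LHS](ACl (5*7*3*((1*4)*(2*9)*(6*8))))%AC /=.
  by rewrite !subrr addNr !addr0 [RHS](ACl (1*4*3*(2*5)))%AC /= addNr addr0.
have c1 := arc_classD k 0 (a i) (a j) (knot_continuous knotK).
have c2 := arc_classD k 0 (a i) (a j) (knot_continuous knotK').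
rewrite -[arc_class (knot_path K') 0 (a j)]c2 -[arc_class (knot_path K) 0 (a j)]c1.
rewrite [arc_class _ (a i) (a j) in LHS]e; first exact: regroup.
by move=> t; exact: cvg_id.
Qed.

End LocalChange.
End InsideDisc.

Section LocalMoves.
Context {R : realType} (S : surface R).
Variables (t0 : R) (K0 : knot_map S).
Hypothesis knotK0 : is_knot K0.
Local Notation k := (path_chain (knot_path K0)).
Local Notation hwp c := (homological_winding_parity t0 K0 c).
Local Notation dgm := (diagram_of_knot t0 K0).
Local Notation iota := (H1mod_chain (l := knot_path K0)).
Implicit Types (D : diagram S).

Lemma hwp_outside n disc (a b : 'I_n -> R) D D' (c : crossing D) (w : crossing D') :
  dgm D -> dgm D' -> local_change disc a b D D' ->
  ~ crossings_in disc D (set_val c) -> set_val w = set_val c -> hwp w = hwp c.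
Proof.
move=> [K rep] [K' rep'] loc nc wc.
have [[cdisc idisc] str str' _ out] := loc.
have [x [y [xy cx]]] := crossing_preimages w.
have cy := esym (over_curve rep' xy).
have Dc : ~ disc_image disc (set_val c).
  by move=> Dc; apply: nc; split=> //; exact: (set_mem (valP c)).
have off t : curve D' (circ_exp t) = set_val c ->
    forall j, ~ oarc (a j) (b j) (circ_exp t).
  move=> ct j tj; apply: Dc; rewrite -ct.
  have [_ _ pre _ _] := str'.
  have : (curve D' @^-1` (disc @` unit_disc)) (circ_exp t).
    by rewrite pre; exists j => //; exact: oarc_arc.
  by [].
have xo := off x (etrans cx wc); have yo := off y (etrans cy (etrans cx wc)).
have [cDx oD] := out _ xo.
have xy' : over D (circ_exp x) (circ_exp y) by apply/oD.
have cx' : curve D (circ_exp x) = set_val c by rewrite -cDx cx.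
apply: (hwp_eq knotK0 rep rep' xy' cx' xy cx).
apply: (local_change_double_point cdisc idisc rep rep' loc xo yo).
by have := over_curve rep xy'; have [_ _ _ ->] := rep.
Qed.

(** Used for the crossings of a move 3: each of them is a crossing of the same two
    strands before and after the move. *)
Lemma hwp_strands n disc (a b : 'I_n -> R) D D' (c : crossing D) (w : crossing D') i j :
  dgm D -> dgm D' -> local_change disc a b D D' ->
  strand_over a b D i j (set_val c) -> strand_over a b D' i j (set_val w) ->
  hwp w = hwp c.
Proof.
move=> [K rep] [K' rep'] loc ci wi.
have [[cdisc idisc] str str' _ _] := loc.
apply: H1mod_chain_hwp_inj => //.
rewrite (parity_strands knotK0 cdisc idisc rep str ci).
rewrite (parity_strands knotK0 cdisc idisc rep' str' wi).
exact: local_change_strand_const rep rep' loc _ _.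
Qed.

Lemma parity_move1 D D' (c : crossing D) : dgm D ->
  move1 D D' (set_val c) -> iota (hwp c) = 0.
Proof.
move=> [K rep] [disc [a [b [[[cdisc idisc] str _ _ _] _ so _]]]].
by rewrite (parity_strands knotK0 cdisc idisc rep str so) subrr.
Qed.

Lemma parity_move2 D D' (c d : crossing D) : dgm D ->
  move2 D D' (set_val c) (set_val d) -> iota (hwp c) = iota (hwp d).
Proof.
move=> [K rep] [disc [a [b [[[cdisc idisc] str _ _ _] _ sc sd _]]]].
rewrite (parity_strands knotK0 cdisc idisc rep str sc).
by rewrite (parity_strands knotK0 cdisc idisc rep str sd).
Qed.

Lemma parity_move3 D D' (c1 c2 c3 : crossing D) w1 w2 w3 : dgm D ->
  move3 D D' (set_val c1) (set_val c2) (set_val c3) w1 w2 w3 ->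
  iota (hwp c1) + iota (hwp c3) = iota (hwp c2).
Proof.
move=> [K rep] [disc [a [b [[[cdisc idisc] str _ _ _] [_ s1 s2 s3] _ _]]]].
rewrite (parity_strands knotK0 cdisc idisc rep str s1).
rewrite (parity_strands knotK0 cdisc idisc rep str s2).
rewrite (parity_strands knotK0 cdisc idisc rep str s3).
by rewrite addrC addrA subrK.
Qed.

Lemma hwp_elementary_move D D' (f : crossing D -> crossing D' -> Prop) X :
  elementary_move f X -> dgm D -> dgm D' ->
  forall v w, f v w -> ~ X v -> hwp w = hwp v.
Proof.
elim=> {D D' f X}.
- by move=> D D' Phi iso dD dD' v w wv _; exact: hwp_isotopy iso wv.
- move=> D D' v [disc [a [b [loc cD _ _]]]] dD dD' c w [cv wc] _.
  by apply: (hwp_outside dD dD' loc _ wc); rewrite cD.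
- move=> D D' v1 v2 [disc [a [b [loc [cD _] _ _ _]]]] dD dD' c w [n1 n2 wc] _.
  by apply: (hwp_outside dD dD' loc _ wc); rewrite cD => -[].
- move=> D D' v1 v2 v3 w1 w2 w3 [disc [a [b [loc [cD s1 s2 s3] [_ s1' s2' s3'] _]]]].
  move=> dD dD' c w [[cv wv]|[cv wv]|[cv wv]|[nc wc]] _.
  + by apply: (hwp_strands dD dD' loc); rewrite ?cv ?wv; [exact: s1|exact: s1'].
  + by apply: (hwp_strands dD dD' loc); rewrite ?cv ?wv; [exact: s2|exact: s2'].
  + by apply: (hwp_strands dD dD' loc); rewrite ?cv ?wv; [exact: s3|exact: s3'].
  + by apply: (hwp_outside dD dD' loc _ wc); rewrite cD.
- move=> D D' v m dD dD' c w wc nX.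
  exact: (hwp_move4 knotK0 (set_val c) dD dD' m nX wc).
- by move=> D D' m dD dD' c w wc _; exact: (hwp_move5 knotK0 (set_val c) dD dD' m wc).
- move=> D D' f X _ ih dD dD' w v fvw nX; apply/esym/ih => //.
  by move=> Xv; apply: nX; exists v.
Qed.

End LocalMoves.

(** * The homological winding parity *)

Theorem theorem3p6 (R : realType) (g : nat) (S : surface R)
    (genus_S : has_genus (R := R) S g) (t0 : R)
    (K0 : knot_map S) (knot_K0 : is_knot K0) (z : S) :
  (forall (K : knot_map S) (D : diagram S) (c : crossing D) (x y : R),
     represents t0 K0 K D -> crossing_parameters D (set_val c) x y ->
     homological_winding_parity t0 K0 c = parity_class t0 K0 K x y) /\
  winding_parity t0 K0
    (- to_H1mod (knot_class K0) (fiber_class z) : H1mod (knot_class K0))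
    (fun D (c : crossing D) => homological_winding_parity t0 K0 c).
Proof.
have inj := H1mod_chain_inj (knot_path_continuous knot_K0) (knot_path01 K0).
have H0 := H1mod_chain0 (knot_path_continuous knot_K0) (knot_path01 K0).
have HD := H1mod_chainD (knot_path_continuous knot_K0) (knot_path01 K0).
have HN := H1mod_chainN (knot_path_continuous knot_K0) (knot_path01 K0).
split; first by move=> K D c x y; exact: parity_class_representative.
split.
- move=> D D' f X dD dD' em v w; exact: (hwp_elementary_move knot_K0 em).
- move=> D D' v dD _ m; apply: inj; rewrite H0; exact: (parity_move1 knot_K0 dD m).
- move=> D D' v1 v2 dD _ m; apply: inj; exact: (parity_move2 knot_K0 dD m).
- move=> D D' v1 v2 v3 w1 w2 w3 dD _ m; apply: inj; rewrite HD.
  exact: (parity_move3 knot_K0 dD m).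
- move=> D D' v v' dD dD' m vv'; apply: inj; rewrite HD HN.
  rewrite (parity_move4 knot_K0 z dD dD' m vv'); congr (- _).
  rewrite H1mod_chain_loop //; [exact: knot_path_continuous|exact: knot_path01| |].
    exact: circle_path_continuous.
  by rewrite -[in RHS](add0r 1) circ_expD1.
Qed.
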